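(* (i) Let $m\in\{2,3\}$. Then every $n\in\mathbb{N}$ can be written as $n=x^2+y^2+z^2+w^2$ with $x,y,z,w\in\mathbb{Z}$ such that $x+y+z+w=t^m$ for some $t\in\mathbb{Z}$. (ii) Let $m,n$ be positive integers with $n\equiv 28\pmod{32}$. If $n$ can be written as $x^2+y^2+z^2+w^2$ with $x,y,z,w\in\mathbb{Z}$ such that $x+y+z+w=t^m$ for some $t\in\mathbb{Z}$, then $m\le 3$.
   Context: $\mathbb{N}=\{0,1,2,\ldots\}$. *)

(* Defs.v *)
From mathcomp Require Import all_boot all_order all_algebra.

Set Implicit Arguments.
Unset Strict Implicit.
Unset Printing Implicit Defensive.

Import GRing.Theory.
Local Open Scope ring_scope.

Definition four_squares_with_sum_power (m n : nat) : Prop :=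
  exists x y z w : int,
    n%:Z = x ^+ 2 + y ^+ 2 + z ^+ 2 + w ^+ 2 /\
    exists t : int, x + y + z + w = t ^+ m.

(* Main.v *)
Require Import Defs.
From mathcomp Require Import all_boot all_order all_algebra.
From mathcomp Require Import zify ring.

(**
  If [n - h^2 = u^2 + v^2 + w^2] with [n] even, then
  [x = (h + u + v + w)/2], [x - v - w], [x - u - w], [x - u - v] are integers whose
  squares sum to [n] and whose sum is [2h]; for odd [n] one uses [4n - 1] in the
  same way.  Part (i) thus reduces to Gauss' three-square theorem for the residues
  [1, 2 mod 4] and [3 mod 8], and part (ii) to the fact that [4^i (8j + 7)] is not
  a sum of three squares.

  The three-square theorem is proved by elementary involutions in the style of
  Liouville, with neither Dirichlet's theorem nor the geometry of numbers.  In the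
  relevant residue classes the number of representations of [k] as a sum of three
  squares is proportional to a weighted number of solutions of [xy + yz + zx = k]
  with [x, y, z >= 0], which is visibly positive.  To see this, sum both counts
  over [k = n - s^2].  The first one becomes a number of representations by four
  squares, a divisor sum by Jacobi's theorem.  The second one counts the solutions
  of [s^2 + xy + yz + zx = n]; as [n] also equals [XZ + YK], where [X = x + s],
  [Z = z + s], [Y = y - s] and [K = x + z], changing the signs of [Y] and [K] cancels
  everything but the solutions with [XYZ = 0], which yield the same divisor sum.
*)

Set Implicit Arguments.
Unset Strict Implicit.
Unset Printing Implicit Defensive.
Import Order.TTheory GRing.Theory Num.Theory.
Local Open Scope ring_scope.

(** * Reindexing finite sums *)

(** Sums over all integers are cut off at a bound that contains every relevant solution, so that
    they become finite sums over lists. *)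
Definition irange (B : nat) : seq int :=
  [seq i%:Z - B%:Z | i <- iota 0 (B.*2.+1)].

Lemma mem_irange B (x : int) : (x \in irange B) = (`|x| <= B%:Z).
Proof.
apply/mapP/idP => [[i]|hx]; first by rewrite mem_iota => hi ->; lia.
by exists (absz (x + B%:Z)); [rewrite mem_iota; lia | lia].
Qed.

Lemma irange_uniq B : uniq (irange B).
Proof. by rewrite map_inj_uniq ?iota_uniq // => i j; lia. Qed.

Lemma big_cond_bij (R : nmodType) (T S : eqType) (U : seq T) (V : seq S)
    (P : pred T) (Q : pred S) (i : T -> S) (j : S -> T) (f : S -> R) :
  uniq U -> uniq V ->
  (forall t, t \in U -> P t -> [/\ i t \in V, Q (i t) & j (i t) = t]) ->
  (forall s, s \in V -> Q s -> [/\ j s \in U, P (j s) & i (j s) = s]) ->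
  \sum_(s <- V | Q s) f s = \sum_(t <- U | P t) f (i t).
Proof.
move=> uU uV hi hj; rewrite -big_filter -[RHS]big_filter.
rewrite -(big_map i xpredT f); apply: perm_big; apply: uniq_perm.
- by rewrite filter_uniq.
- rewrite map_inj_in_uniq ?filter_uniq // => t t'; rewrite !mem_filter.
  by case/andP=> Pt /hi/(_ Pt)[_ _ {2}<-] /andP[Pt' /hi/(_ Pt')[_ _ {2}<-]] ->.
move=> s; rewrite mem_filter; apply/andP/mapP => [[Qs /hj/(_ Qs)[js Pj is_]]|].
  by exists (j s) => //; rewrite mem_filter js Pj.
by case=> t; rewrite mem_filter => /andP[Pt /hi/(_ Pt)[it Qt _]] ->.
Qed.

(** A sign-reversing involution shows that the sum equals its own opposite. It is only required
    where [f t != 0], because a reflection of a box may leave the box elsewhere. *)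
Lemma big_antisym (T : eqType) (U : seq T) (P : pred T) (i : T -> T)
    (f : T -> int) :
  uniq U ->
  (forall t, t \in U -> P t -> f t != 0 ->
     [/\ i t \in U, P (i t), i (i t) = t & f (i t) = - f t]) ->
  \sum_(t <- U | P t) f t = 0.
Proof.
move=> uU h; pose Q t := P t && (f t != 0).
have -> : \sum_(t <- U | P t) f t = \sum_(t <- U | Q t) f t.
  rewrite [LHS](bigID (fun t => f t != 0)) /=.
  by rewrite [X in _ + X]big1 ?addr0 // => t /andP[_ /negbNE/eqP].
have hi t : t \in U -> Q t -> [/\ i t \in U, Q (i t) & i (i t) = t].
  move=> tU /andP[Pt ft]; have [iU Pi ii fi] := h t tU Pt ft.
  by split; rewrite // /Q Pi fi oppr_eq0.
have {hi} e := big_cond_bij f uU uU hi hi.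
have {e} : \sum_(t <- U | Q t) f t = - \sum_(t <- U | Q t) f t.
  rewrite {1}e -sumrN big_seq_cond [RHS]big_seq_cond; apply: eq_bigr => t.
  by case/and3P => tU Pt /(h t tU Pt)[].
by set S := \sum_(t <- U | Q t) f t; lia.
Qed.

Definition pairs (T S : Type) (U : seq T) (V : seq S) : seq (T * S) :=
  [seq (x, y) | x <- U, y <- V].

Lemma mem_pairs (T S : eqType) (U : seq T) (V : seq S) x y :
  ((x, y) \in pairs U V) = (x \in U) && (y \in V).
Proof.
by apply/allpairsP/andP => [[[? ?] /= [? ? [-> ->]]]|[? ?]]; last exists (x, y).
Qed.

Lemma pairs_uniq (T S : eqType) (U : seq T) (V : seq S) :
  uniq U -> uniq V -> uniq (pairs U V).
Proof. by move=> uU uV; apply: allpairs_uniq => // -[? ?] [? ?]. Qed.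

Lemma big_pairs (R : nmodType) (T S : Type) (U : seq T) (V : seq S)
    (P : T -> S -> bool) (f : T -> S -> R) :
  \sum_(p <- pairs U V | P p.1 p.2) f p.1 p.2 =
  \sum_(x <- U) \sum_(y <- V | P x y) f x y.
Proof.
rewrite big_mkcond big_allpairs; apply: eq_bigr => x _ /=.
by rewrite -big_mkcond.
Qed.

(** The theta series over one parity class, truncated to a polynomial; its coefficients of degree at
    most [B] are already exact. *)
Definition theta (a : int) B : {poly int} :=
  \sum_(s <- irange B | (s %% 2)%Z == a) 'X^(absz s ^ 2).

Lemma coef_thetaM a B p n :
  (theta a B * p)`_n =
  \sum_(s <- irange B | ((s %% 2)%Z == a) && (absz s ^ 2 <= n)%N)
     p`_(n - absz s ^ 2)%N.
Proof.
rewrite /theta mulr_suml coef_sum big_mkcondr /=.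
by apply: eq_bigr => s _; rewrite coefXnM ltnNge; case: (_ <= _)%N.
Qed.

Lemma coef_theta_supp a B n : (theta a B)`_n != 0 ->
  exists2 s : int, (s %% 2)%Z = a & n%:Z = s ^+ 2.
Proof.
rewrite -[theta a B]mulr1 coef_thetaM => h.
have : has (fun s : int => ((s %% 2)%Z == a) && (n%:Z == s ^+ 2)) (irange B).
  apply: contraNT h => /hasPn h; rewrite big_seq_cond big1 // => s.
  case/andP => /h hs /andP[sa sn]; rewrite coef1.
  by move: hs; rewrite sa /=; case: eqP => //= ?; nia.
by case/hasP => s _ /andP[/eqP sa /eqP sn]; exists s.
Qed.

Lemma coefM_supp (p q : {poly int}) n : (p * q)`_n != 0 ->
  exists i j, [/\ n = (i + j)%N, p`_i != 0 & q`_j != 0].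
Proof.
rewrite coefM => h.
have : [exists i : 'I_n.+1, p`_i * q`_(n - i) != 0].
  apply: contraNT h; rewrite negb_exists => /forallP h.
  by rewrite big1 // => i _; apply/eqP/negbNE/h.
case/existsP => i; rewrite mulf_eq0 negb_or => /andP[pi qi].
by exists i, (n - i)%N; split=> //; rewrite subnKC // -ltnS.
Qed.

(** This is $(-1)^a$ for an integer exponent, written so that [lia] can evaluate it. *)
Definition chi (a : int) : int := 1 - 2 * (a %% 2)%Z.

(** * Jacobi's four-square theorem *)

Lemma chiM (a b : int) : chi (a + b) = chi a * chi b.
Proof.
rewrite /chi.
have [ea | ea] : (a %% 2 = 0 \/ a %% 2 = 1)%Z by lia.
  by have -> : ((a + b) %% 2)%Z = (b %% 2)%Z; lia.
by have -> : ((a + b) %% 2)%Z = 1 - (b %% 2)%Z; lia.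
Qed.

Definition box2 B := pairs (irange B) (irange B).
Definition box3 B := pairs (box2 B) (irange B).

Lemma box2_uniq B : uniq (box2 B).
Proof. by rewrite pairs_uniq ?irange_uniq. Qed.

Lemma box3_uniq B : uniq (box3 B).
Proof. by rewrite pairs_uniq ?irange_uniq ?box2_uniq. Qed.

Lemma mem_box2 B (x y : int) :
  ((x, y) \in box2 B) = (`|x| <= B%:Z) && (`|y| <= B%:Z).
Proof. by rewrite mem_pairs !mem_irange. Qed.

Lemma mem_box3 B (x y z : int) :
  ((x, y, z) \in box3 B) = [&& `|x| <= B%:Z, `|y| <= B%:Z & `|z| <= B%:Z].
Proof. by rewrite mem_pairs mem_box2 mem_irange andbA. Qed.

Lemma sum_irange_recr B (j : nat) (F : int -> int) : (j < B)%N ->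
  \sum_(d <- irange B | (0 < d) && (d <= j.+1%:Z)) F d =
  \sum_(d <- irange B | (0 < d) && (d <= j%:Z)) F d + F j.+1%:Z.
Proof.
move=> jB; rewrite -big_filter (bigD1_seq j.+1%:Z) ?filter_uniq ?irange_uniq //.
  by rewrite big_filter_cond addrC; congr (_ + _); apply: eq_bigl => d; lia.
by rewrite mem_filter mem_irange; lia.
Qed.

Lemma sum_chi_mul_sub B (r : int) : 0 < r -> 2 * r - 1 <= B%:Z ->
  \sum_(d <- irange B | (0 < d) && (d < 2 * r)) chi d * (d * (2 * r - d)) = - r.
Proof.
move=> r0 rB; pose F d := chi d * (d * (2 * r - d)).
(* Closed form of the doubled partial sums. At [j = 2r - 1] the bracket reduces to [r] and the sign
   is negative, which gives [-2r]. *)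
have H (j : nat) : (j <= B)%N ->
    2 * (\sum_(d <- irange B | (0 < d) && (d <= j%:Z)) F d) =
    chi j%:Z * (2 * r * j%:Z + r - j%:Z * (j%:Z + 1)) - r.
  elim: j => [|j IH] hj.
    by rewrite big1 /chi /=; [lia | move=> d; lia].
  rewrite sum_irange_recr // mulrDr IH ?(ltnW hj) // /F.
  have -> : chi j.+1%:Z = - chi j%:Z by rewrite /chi; lia.
  have -> : j.+1%:Z = j%:Z + 1 by lia.
  by ring.
have := H (absz (2 * r - 1)%R).
have -> : (absz (2 * r - 1)%R)%:Z = 2 * r - 1 by lia.
have -> : chi (2 * r - 1) = -1 by rewrite /chi; lia.
rewrite (eq_bigl (fun d => (0 < d) && (d < 2 * r))); last by move=> d; lia.
by rewrite /F; set S := \sum_(d <- _ | _) _ => h; nia.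
Qed.

(* The cubic [(2s + d)(e - 2s)(d + e)] is odd under two reflections preserving
   [s^2 + de]: one acts on the solutions with [2s + d < e], the other on those with
   [e < 2s + d]; on the remaining wall [n = (s + d)^2].  Modulo the swap of [d] and
   [e], the cubic is [2 (de - 4s^2) d]. *)
Lemma liouville_sum B (n : nat) : (0 < n <= B)%N ->
  \sum_(t <- box3 B | let: (s, d, e) := t in
       [&& 0 < d, 0 < e & s ^+ 2 + d * e == n%:Z])
    (let: (s, d, e) := t in chi (s + d + e) * ((n%:Z - 5 * s ^+ 2) * d)) =
  - \sum_(r <- irange B | (0 < r) && (r ^+ 2 == n%:Z)) chi r * n%:Z.
Proof.
move=> /andP[n0 nB].
pose P (t : int * int * int) := let: (s, d, e) := t in
  [&& 0 < d, 0 < e & s ^+ 2 + d * e == n%:Z].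
pose h (t : int * int * int) := let: (s, d, e) := t in
  chi (s + d + e) * ((2 * s + d) * (e - 2 * s) * (d + e)).
have PB t : P t -> t \in box3 B.
  by case: t => [[s d] e] /= /and3P[d0 e0 /eqP E]; rewrite mem_box3; nia.
rewrite -/P.
(* On the solutions [de - 4s^2 = n - 5s^2]; what remains of the cubic is antisymmetric in [d] and
   [e]. *)
have swap : \sum_(t <- box3 B | P t) (let: (s, d, e) := t in chi (s + d + e) *
    ((2 * s + d) * (e - 2 * s) * (d + e) - 2 * ((n%:Z - 5 * s ^+ 2) * d))) = 0.
  apply: (big_antisym (i := fun t => let: (s, d, e) := t in (s, e, d))).
    exact: box3_uniq.
  move=> [[s d] e] _ Pt _; have Pt' : P (s, e, d) by move: Pt => /=; lia.
  split=> //; first exact: PB.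
  move: Pt => /= /and3P[_ _ /eqP <-].
  have -> : s + e + d = s + d + e by ring.
  by ring.
have H1 : \sum_(t <- box3 B | P t && (let: (s, d, e) := t in 2 * s + d < e))
    h t = 0.
  apply: (big_antisym
    (i := fun t => let: (s, d, e) := t in (- s - d, d, e - 2 * s - d))).
    exact: box3_uniq.
  move=> [[s d] e] _ /andP[Pt lt] _.
  have Pt' : P (- s - d, d, e - 2 * s - d) by move: Pt => /=; lia.
  split; [exact: PB | by rewrite Pt' /=; move: Pt => /=; lia | congr (_, _, _); lia |].
  rewrite /h; have -> : chi (- s - d + d + (e - 2 * s - d)) = chi (s + d + e).
    by rewrite /chi; lia.
  by ring.
have H2 : \sum_(t <- box3 B | P t && (let: (s, d, e) := t in e < 2 * s + d))
    h t = 0.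
  apply: (big_antisym
    (i := fun t => let: (s, d, e) := t in (e - s, d + 2 * s - e, e))).
    exact: box3_uniq.
  move=> [[s d] e] _ /andP[Pt lt] _.
  have Pt' : P (e - s, d + 2 * s - e, e) by move: Pt => /=; lia.
  split; [exact: PB | by rewrite Pt' /=; move: Pt => /=; lia | congr (_, _, _); lia |].
  rewrite /h; have -> : chi (e - s + (d + 2 * s - e) + e) = chi (s + d + e).
    by rewrite /chi; lia.
  by ring.
(* With [r = s + d] the wall is parametrised by [r^2 = n] and [0 < d < 2r]; there [e = 2r - d] and
   the cubic becomes [2r d (2r - d)]. *)
have H3 : \sum_(t <- box3 B | P t && (let: (s, d, e) := t in e == 2 * s + d))
    h t = 2 * - \sum_(r <- irange B | (0 < r) && (r ^+ 2 == n%:Z)) chi r * n%:Z.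
  pose Q (p : int * int) :=
    ((0 < p.1) && (p.1 ^+ 2 == n%:Z)) && ((0 < p.2) && (p.2 < 2 * p.1)).
  rewrite (big_cond_bij (U := box2 B) (P := Q)
    (i := fun p => (p.1 - p.2, p.2, 2 * p.1 - p.2))
    (j := fun t => let: (s, d, e) := t in (s + d, d)));
    rewrite ?box2_uniq ?box3_uniq //; last first.
  - move=> [[s d] e] _ /andP[/and3P[d0 e0 /eqP E] /eqP e2].
    rewrite mem_box2 /Q /= ; split; [nia | nia | congr (_, _, _); lia].
  - move=> [r d] _ /andP[/andP[/= r0 /eqP rn] /andP[/= d0 d2]].
    have Pt : P (r - d, d, 2 * r - d).
      rewrite /= d0 -rn /=; apply/andP; split; first by lia.
      by apply/eqP; ring.
    by split; [exact: PB | apply/andP; split; [exact: Pt | lia] | congr (_, _); lia].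
  rewrite (big_pairs _ _ (fun r d => ((0 < r) && (r ^+ 2 == n%:Z)) &&
      ((0 < d) && (d < 2 * r))) (fun r d => h (r - d, d, 2 * r - d))).
  rewrite mulrN mulr_sumr -sumrN [RHS]big_mkcond; apply: eq_bigr => r _.
  case: ifP => [/andP[r0 /eqP rn] | _] /=; last by rewrite big_pred0.
  transitivity (chi r * (2 * r) *
      \sum_(d <- irange B | (0 < d) && (d < 2 * r)) chi d * (d * (2 * r - d))).
    rewrite mulr_sumr; apply: eq_bigr => d _; rewrite /h.
    have -> : chi (r - d + d + (2 * r - d)) = chi r * chi d.
      by rewrite -chiM /chi; lia.
    by ring.
  have rB : 2 * r - 1 <= B%:Z by nia.
  by rewrite sum_chi_mul_sub // -rn; ring.
have : \sum_(t <- box3 B | P t) h t =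
    2 * - \sum_(r <- irange B | (0 < r) && (r ^+ 2 == n%:Z)) chi r * n%:Z.
  rewrite -H3 [LHS](bigID (fun t => let: (s, d, e) := t in 2 * s + d < e)) /=.
  rewrite H1 add0r.
  rewrite [LHS](bigID (fun t => let: (s, d, e) := t in e < 2 * s + d)) /=.
  rewrite [X in X + _](_ : _ = 0); last first.
    by rewrite -[RHS]H2; apply: eq_bigl => -[[s d] e] /=; lia.
  by rewrite add0r; apply: eq_bigl => -[[s d] e] /=; lia.
set X := \sum_(t <- _ | P t) h t; set Y := - _; set Z := \sum_(t <- _ | P t) _.
have -> : X = 2 * Z; last by lia.
apply/eqP; rewrite -subr_eq0 -[X in _ == X]swap; apply/eqP.
rewrite /X /Z mulr_sumr -sumrB; apply: eq_bigr => -[[s d] e] _ /=; ring.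
Qed.

Definition theta_full B := theta 0 B + theta 1 B.

Lemma theta_fullE B : theta_full B = \sum_(s <- irange B) 'X^(absz s ^ 2).
Proof.
rewrite /theta_full /theta [RHS](bigID (fun s : int => (s %% 2)%Z == 0)) /=.
by congr (_ + _); apply: eq_bigl => s; lia.
Qed.

Lemma coef_theta_fullM B (p : {poly int}) n :
  (theta_full B * p)`_n =
  \sum_(s <- irange B | (absz s ^ 2 <= n)%N) p`_(n - absz s ^ 2)%N.
Proof.
rewrite theta_fullE mulr_suml coef_sum [RHS]big_mkcond.
by apply: eq_bigr => s _; rewrite coefXnM ltnNge; case: (_ <= _)%N.
Qed.

Lemma coefX_deriv (p : {poly int}) n : ('X * p^`())`_n = n%:Z * p`_n.
Proof.
by rewrite coefXM coef_deriv; case: n => [|n] /=; rewrite ?mul0r // -mulr_natl natz.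
Qed.

(* The logarithmic derivative: [theta * (theta ^ 4)' = 4 * theta' * theta ^ 4]. *)
Lemma coef_theta4_rec B n :
  \sum_(s <- irange B | (absz s ^ 2 <= n)%N)
    (n%:Z - 5 * s ^+ 2) * (theta_full B ^+ 4)`_(n - absz s ^ 2)%N = 0.
Proof.
set F := theta_full B ^+ 4.
have E : theta_full B * ('X * F^`()) = ('X * (theta_full B)^`()) * F *+ 4.
  rewrite /F deriv_exp /=; ring.
have E' : 'X * (theta_full B)^`() =
    \sum_(s <- irange B) (s ^+ 2) *: 'X^(absz s ^ 2) :> {poly int}.
  apply/polyP => n'; rewrite coefX_deriv theta_fullE !coef_sum mulr_sumr.
  apply: eq_bigr => s _; rewrite coefZ coefXn.
  by case: eqP => [->|]; rewrite ?mulr0 ?mulr1 //; lia.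
have := congr1 (fun p : {poly int} => p`_n) E.
rewrite /= coef_theta_fullM coefMn E' mulr_suml coef_sum => {E'} {}E.
(* The factor [n - s^2] comes from differentiating [theta ^ 4] and [4 s^2] from differentiating
   [theta]. *)
rewrite (eq_bigr (fun s : int => (n - absz s ^ 2)%N%:Z * F`_(n - absz s ^ 2)%N
   - 4 * (s ^+ 2 * F`_(n - absz s ^ 2)%N))); last first.
  move=> s sn; have -> : (n - absz s ^ 2)%N%:Z = n%:Z - s ^+ 2 by lia.
  by ring.
rewrite sumrB; apply/eqP; rewrite subr_eq0; apply/eqP.
rewrite (eq_bigr (fun s : int => ('X * F^`())`_(n - absz s ^ 2)%N)); last first.
  by move=> s _; rewrite coefX_deriv.
rewrite E -mulr_sumr -[LHS]mulr_natl natz; congr (_ * _).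
rewrite [RHS]big_mkcond; apply: eq_bigr => s _.
by rewrite -scalerAl coefZ coefXnM ltnNge; case: (_ <= _)%N; rewrite /= ?mulr0.
Qed.

Lemma coef0_theta4 B : (theta_full B ^+ 4)`_0 = 1.
Proof.
have H : (theta_full B)`_0 = 1.
  rewrite theta_fullE coef_sum (bigD1_seq 0) ?irange_uniq ?mem_irange //.
  by rewrite coefXn /= big1 ?addr0 // => s s0; rewrite coefXn; lia.
by rewrite !exprS expr0 mulr1 !coef0M H.
Qed.

(** A divisor sum that keeps both complementary factors, so that exchanging them is a symmetry. For
    [k <= B] no factorization is lost. *)
Definition dsum B (k : int) (f : int -> int -> int) : int :=
  \sum_(p <- box2 B | [&& 0 < p.1, 0 < p.2 & p.1 * p.2 == k]) f p.1 p.2.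

Lemma chi_sqr (a : int) : chi a * chi a = 1.
Proof. by rewrite -chiM /chi; lia. Qed.

Lemma odd_evenP (x : int) : exists y, x = 2 * y \/ x = 2 * y + 1.
Proof. exists (x %/ 2)%Z; lia. Qed.

Lemma chi_exp2 (a : int) : chi (a ^+ 2) = chi a.
Proof.
by rewrite /chi; have [y [->|->]] := odd_evenP a; rewrite expr2; lia.
Qed.

(** This is the recurrence of [coef_theta4_rec] for the divisor sums. Grouping the solutions in
    [liouville_sum] by [s] produces the divisor sums of [n - s^2], and the value 1 at [k = 0]
    accounts for its right-hand side. *)
Lemma dsum_theta_rec B (n : nat) : (0 < n <= B)%N ->
  \sum_(s <- irange B | (absz s ^ 2 <= n)%N) (n%:Z - 5 * s ^+ 2) *
    (let k := (n - absz s ^ 2)%N in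
     if k == 0%N then 1 else
     - 8 * chi k%:Z * dsum B k%:Z (fun d e => chi (d + e) * d)) = 0.
Proof.
move=> nB'; have /andP[n0 nB] := nB'.
pose N := \sum_(r <- irange B | (0 < r) && (r ^+ 2 == n%:Z)) (1 : int).
have E1 : \sum_(s <- irange B | s ^+ 2 == n%:Z) (1 : int) = 2 * N.
  rewrite (bigID (fun s => 0 < s)) /= mulr2n mulrDl !mul1r; congr (_ + _).
    by apply: eq_bigl => s; rewrite andbC.
  apply: (big_cond_bij (i := fun s => - s) (j := fun s => - s));
    rewrite ?irange_uniq // => s; rewrite !mem_irange => hs /andP[h1 h2].
    by split; [lia | rewrite sqrrN; nia | lia].
  by split; [lia | rewrite sqrrN; nia | lia].
have E2 := liouville_sum nB'.
have E3 : \sum_(r <- irange B | (0 < r) && (r ^+ 2 == n%:Z)) chi r * n%:Z =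
    chi n%:Z * n%:Z * N.
  rewrite mulr_sumr; apply: eq_bigr => r /andP[_ /eqP <-].
  by rewrite chi_exp2 mulr1.
rewrite E3 in E2.
(* The terms with [s^2 = n] add up to [-8nN]; they cancel the [8nN] supplied by [liouville_sum]. *)
rewrite (bigID (fun s : int => s ^+ 2 == n%:Z)) /=.
rewrite [X in X + _](_ : _ = - 4 * n%:Z * (2 * N)); last first.
  rewrite -E1 mulr_sumr; apply: eq_big => [s|s /andP[h1 /eqP h2]]; first by lia.
  have -> : (n - absz s ^ 2 == 0)%N by lia.
  by rewrite /= h2; ring.
rewrite [X in _ + X](_ : _ = - 8 * chi n%:Z * - (chi n%:Z * n%:Z * N)).
  transitivity (8 * n%:Z * N * (chi n%:Z * chi n%:Z - 1)); first by ring.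
  by rewrite chi_sqr subrr mulr0.
rewrite -E2 mulr_sumr.
rewrite (eq_bigl (fun t : int * int * int => [&& 0 < t.1.2, 0 < t.2
    & t.1.1 ^+ 2 + t.1.2 * t.2 == n%:Z])); last by case=> [[]].
rewrite [RHS](eq_bigr (fun t : int * int * int => - 8 * chi n%:Z *
   (chi (t.1.1 + t.1.2 + t.2) * ((n%:Z - 5 * t.1.1 ^+ 2) * t.1.2)))); last by case=> [[]].
rewrite (big_pairs _ _ (fun (p : int * int) e => [&& 0 < p.2, 0 < e
    & p.1 ^+ 2 + p.2 * e == n%:Z]) (fun (p : int * int) e => - 8 * chi n%:Z *
   (chi (p.1 + p.2 + e) * ((n%:Z - 5 * p.1 ^+ 2) * p.2)))).
rewrite /box2 /pairs big_allpairs /= [LHS]big_mkcond; apply: eq_bigr => s _.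
case: ifP => [/andP[h1 h2]|h].
  have -> : (n - absz s ^ 2 == 0)%N = false by lia.
  have -> : (n - absz s ^ 2)%N%:Z = n%:Z - s ^+ 2 by lia.
  rewrite /dsum (big_pairs _ _ (fun d e => [&& 0 < d, 0 < e & d * e == n%:Z - s ^+ 2])
     (fun d e => chi (d + e) * d)) !mulr_sumr; apply: eq_bigr => d _.
  rewrite !mulr_sumr; apply: eq_big => [e|e _]; first by lia.
  have -> : chi (n%:Z - s ^+ 2) = chi n%:Z * chi s.
    by rewrite -[chi s]chi_exp2 -chiM /chi; lia.
  by rewrite !chiM; ring.
rewrite big1 // => d _; rewrite big_pred0 // => e; apply/negP => /and3P[d0 e0 /eqP E].
by nia.
Qed.

(** Jacobi's theorem in a signed form. In the common recurrence the term [s = 0] carries the nonzero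
    factor [n] and all others have a smaller index, so the value at 0 determines the whole
    sequence. *)
Lemma coef_theta4 B n : (0 < n <= B)%N -> (theta_full B ^+ 4)`_n =
  - 8 * chi n%:Z * dsum B n%:Z (fun d e => chi (d + e) * d).
Proof.
pose G k := if k == 0%N then 1 else
     - 8 * chi k%:Z * dsum B k%:Z (fun d e => chi (d + e) * d).
suff H : (n <= B)%N -> (theta_full B ^+ 4)`_n = G n.
  by case/andP=> n0 nB; rewrite H // /G; case: n n0 {nB H}.
have [m] := ubnP n; elim: m n => // m IH [|n] nm nB; first exact: coef0_theta4.
have E1 := coef_theta4_rec B n.+1.
have /dsum_theta_rec E2 : (0 < n.+1 <= B)%N by [].
move: E1; rewrite -[RHS]E2 => /eqP; rewrite -subr_eq0 -sumrB => /eqP.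
rewrite big_mkcond (bigD1_seq 0) ?irange_uniq ?mem_irange //=.
rewrite big1_seq ?addr0 => [|s /andP[s0 _]].
  rewrite (_ : (n.+1 - 0 ^ 2)%N = n.+1) // -mulrBr => /eqP.
  rewrite mulf_eq0 subr_eq0.
  by move=> /orP[|/eqP].
case: ifP => // sn; rewrite IH ?subrr //; last by lia.
have : (0 < absz s ^ 2)%N by rewrite expn_gt0; lia.
by lia.
Qed.

(** * Four squares with prescribed parities *)

Lemma eq_dsum B k (f g : int -> int -> int) :
  (forall d e, 0 < d -> 0 < e -> d * e = k -> f d e = g d e) ->
  dsum B k f = dsum B k g.
Proof. by move=> fg; apply: eq_bigr => p /and3P[? ? /eqP ?]; apply: fg. Qed.

Lemma dsum_lin B k (c c' : int) (f g : int -> int -> int) :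
  dsum B k (fun d e => c * f d e + c' * g d e) = c * dsum B k f + c' * dsum B k g.
Proof. by rewrite /dsum big_split /= -!mulr_sumr. Qed.

Lemma dsumC B k (f : int -> int -> int) :
  dsum B k f = dsum B k (fun d e => f e d).
Proof.
apply: (big_cond_bij (fun p => f p.1 p.2) (i := fun p => (p.2, p.1))
  (j := fun p => (p.2, p.1))); rewrite ?box2_uniq // => -[d e];
  rewrite !mem_box2 /= => h1 h2; split=> //; lia.
Qed.

(** The divisibility conditions sit inside the summand so that such sums can be combined by
    [dsum_lin]. *)
Lemma dsum_scale B (u v m : int) (f : int -> int -> int) :
  0 < u -> 0 < v -> u * v * m <= B%:Z ->
  dsum B (u * v * m) (fun d e =>
    if ((d %% u)%Z == 0) && ((e %% v)%Z == 0) then f d e else 0) =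
  dsum B m (fun d e => f (u * d) (v * e)).
Proof.
move=> u0 v0 B0; rewrite /dsum -big_mkcondr /=.
apply: (big_cond_bij (fun p => f p.1 p.2) (i := fun p => (u * p.1, v * p.2))
  (j := fun p => (p.1 %/ u, p.2 %/ v)%Z)); rewrite ?box2_uniq // => -[d e] _ /=.
  move=> /and3P[d0 e0 /eqP E]; rewrite mem_box2 /=.
  have d0' : 0 < u * d by rewrite mulr_gt0.
  have e0' : 0 < v * e by rewrite mulr_gt0.
  have E' : u * d * (v * e) = u * v * m by rewrite -E; ring.
  split; first by nia.
    by rewrite d0' e0' E' eqxx !modzMr.
  by congr (_, _); rewrite mulKz //; lia.
move=> /andP[/and3P[d0 e0 /eqP E] /andP[du ev]].
have [d' ed] : exists d', d = u * d' by exists (d %/ u)%Z; lia.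
have [e' ee] : exists e', e = v * e' by exists (e %/ v)%Z; lia.
have uu : u != 0 by lia.
have vv : v != 0 by lia.
move: d0 e0 E; rewrite mem_box2 ed ee !mulKz //= => d0 e0 E.
have {}d0 : 0 < d' by rewrite pmulr_rgt0 in d0.
have {}e0 : 0 < e' by rewrite pmulr_rgt0 in e0.
have E' : d' * e' = m.
  have uv : u * v != 0 by rewrite mulf_neq0.
  by apply: (mulfI uv); rewrite -E; ring.
have uv0 : 0 < u * v by rewrite mulr_gt0.
split=> //; last by rewrite d0 e0 E' eqxx.
by nia.
Qed.

Lemma chiP (a : int) :
  (chi a = 1 /\ (a %% 2)%Z = 0) \/ (chi a = -1 /\ (a %% 2)%Z = 1).
Proof. by rewrite /chi; lia. Qed.

Definition sigma B (m : int) := dsum B m (fun d _ => d).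

Lemma sigma_box B B' (m : nat) : (m <= B)%N -> (m <= B')%N ->
  sigma B m%:Z = sigma B' m%:Z.
Proof.
move=> mB mB'; apply: (big_cond_bij (fun p => p.1) (i := id) (j := id));
  rewrite ?box2_uniq // => -[d e]; rewrite !mem_box2 /= => _ /and3P[d0 e0 /eqP E];
  by split=> //; [nia | rewrite d0 e0 E eqxx].
Qed.

Section OddPart.
Variables (B : nat) (m : nat).
Hypothesis m_odd : odd m.

Lemma dsum_chi_odd : dsum B m%:Z (fun d e => chi (d + e) * d) = sigma B m%:Z.
Proof.
apply: eq_dsum => d e _ _ E; rewrite (_ : chi _ = 1) ?mul1r //.
have [d' [dE|dE]] := odd_evenP d; have [e' [eE|eE]] := odd_evenP e;
  by move: E; rewrite /chi dE eE; lia.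
Qed.

Lemma dsum_scale_fst (u v : nat) : (0 < u)%N -> (0 < v)%N -> (u * v * m <= B)%N ->
  dsum B (u * v * m)%N%:Z (fun d e =>
    if ((d %% u%:Z)%Z == 0) && ((e %% v%:Z)%Z == 0) then d else 0) =
  u%:Z * sigma B m%:Z.
Proof.
move=> u0 v0 uvB; rewrite !PoszM dsum_scale //; try lia.
by rewrite /sigma /dsum -mulr_sumr.
Qed.

(** Exactly one of the factors is even, so every sign is negative; an even [d] yields twice the
    divisor sum of [m], an even [e] yields it once. *)
Lemma dsum_chi_2odd : (2 * m <= B)%N ->
  dsum B (2 * m)%N%:Z (fun d e => chi (d + e) * d) = - 3 * sigma B m%:Z.
Proof.
move=> mB; have h1 := dsum_scale_fst (u := 2) (v := 1) isT isT.
have h2 := dsum_scale_fst (u := 1) (v := 2) isT isT.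
rewrite !muln1 !mul1n in h1 h2.
transitivity (- 1 * (2 * sigma B m%:Z) + - 1 * (1 * sigma B m%:Z)); last by ring.
rewrite -h1 // -h2 // -dsum_lin; apply: eq_dsum => d e _ _ E.
have [d' [dE|dE]] := odd_evenP d; have [e' [eE|eE]] := odd_evenP e;
  move: E; case: (chiP (d + e)) => -[-> c]; case: ifP; case: ifP;
  by move: c; rewrite dE eE; lia.
Qed.

(** Either 4 divides [d], or 4 divides [e], or both factors are even; with their signs these cases
    contribute [-4], [-1] and [+2] times the divisor sum of [m]. *)
Lemma dsum_chi_4odd : (4 * m <= B)%N ->
  dsum B (4 * m)%N%:Z (fun d e => chi (d + e) * d) = - 3 * sigma B m%:Z.
Proof.
move=> mB; have h1 := dsum_scale_fst (u := 4) (v := 1) isT isT.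
have h2 := dsum_scale_fst (u := 1) (v := 4) isT isT.
have h3 := dsum_scale_fst (u := 2) (v := 2) isT isT.
rewrite !muln1 !mul1n in h1 h2 h3.
transitivity (- 1 * (4 * sigma B m%:Z) + 1 *
  (- 1 * (1 * sigma B m%:Z) + 1 * (2 * sigma B m%:Z))); last by ring.
rewrite -h1 // -h2 // -h3 // -!dsum_lin; apply: eq_dsum => d e _ _ E.
have [d' [dE|dE]] := odd_evenP d; have [e' [eE|eE]] := odd_evenP e;
have [d'' [dE'|dE']] := odd_evenP d'; have [e'' [eE'|eE']] := odd_evenP e';
  move: E; case: (chiP (d + e)) => -[-> c]; case: ifP; case: ifP; case: ifP;
  by move: c; rewrite dE eE dE' eE'; lia.
Qed.

End OddPart.

(** Squares of parity [a] are congruent to [a] modulo 4, so a product of theta series lives in a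
    single class modulo 4. This selects the products that contribute to a given coefficient. *)
Definition supp4 (p : {poly int}) (c : int) :=
  forall n, p`_n != 0 -> (n%:Z %% 4 = c %% 4)%Z.

Lemma supp4_theta a B : (a == 0) || (a == 1) -> supp4 (theta a B) a.
Proof.
move=> ha n /coef_theta_supp[s sa ->].
by have [t [tE|tE]] := odd_evenP s; move: sa ha; rewrite tE expr2; lia.
Qed.

Lemma supp4M p q c c' : supp4 p c -> supp4 q c' -> supp4 (p * q) (c + c').
Proof.
move=> hp hq n /coefM_supp[i [j [-> /hp hi /hq hj]]].
by rewrite PoszD; lia.
Qed.

Lemma supp4_coef0 p c n : supp4 p c -> (n%:Z %% 4)%Z != (c %% 4)%Z -> p`_n = 0.
Proof. by move=> h; apply: contraNeq => /h ->. Qed.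

(** Even [s] are doubled integers, with squares multiplied by 4. The doubled bound makes the two
    truncations match exactly. *)
Lemma theta0_comp B : theta 0 B.*2 = theta_full B \Po 'X^4.
Proof.
rewrite theta_fullE /theta raddf_sum /=.
rewrite [RHS](eq_bigr (fun s => 'X^(absz (2 * s)%R ^ 2))) => [|s _]; last first.
  by rewrite comp_Xn_poly -exprM; congr ('X^_); lia.
rewrite [RHS](_ : _ = \sum_(s <- irange B | xpredT s) 'X^(absz (2 * s)%R ^ 2)) //.
apply: (big_cond_bij (fun s => 'X^(absz s ^ 2) : {poly int}) (i := fun s => 2 * s)
  (j := fun s => (s %/ 2)%Z)); rewrite ?irange_uniq // => s; rewrite !mem_irange.
  by split; lia.
by move=> ? ?; split; lia.
Qed.

(** Modulo 4 only the term with two even and two odd squares reaches [2m]; it has multiplicity 6,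
    and the full coefficient is 24 times the divisor sum. *)
Lemma coef_theta22 B (m : nat) : odd m -> (2 * m <= B)%N ->
  (theta 0 B ^+ 2 * theta 1 B ^+ 2)`_(2 * m) = 4 * sigma B m%:Z.
Proof.
move=> mo mB; have h0 := @supp4_theta 0 B isT; have h1 := @supp4_theta 1 B isT.
have := @coef_theta4 B (2 * m); rewrite dsum_chi_2odd //.
have -> : chi (2 * m)%N%:Z = 1 by rewrite /chi; lia.
have -> : theta_full B ^+ 4 =
   theta 0 B * (theta 0 B * (theta 0 B * theta 0 B)) +
   (theta 0 B * (theta 0 B * (theta 0 B * theta 1 B))) *+ 4 +
   (theta 0 B ^+ 2 * theta 1 B ^+ 2) *+ 6 +
   (theta 0 B * (theta 1 B * (theta 1 B * theta 1 B))) *+ 4 +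
   theta 1 B * (theta 1 B * (theta 1 B * theta 1 B)).
  by rewrite /theta_full; ring.
rewrite !coefD.
rewrite (supp4_coef0 (supp4M h0 (supp4M h0 (supp4M h0 h0)))); last by lia.
rewrite (supp4_coef0 (supp4M h0 (supp4M h0 (supp4M h0 h1)))); last by lia.
rewrite (supp4_coef0 (supp4M h0 (supp4M h1 (supp4M h1 h1)))); last by lia.
rewrite (supp4_coef0 (supp4M h1 (supp4M h1 (supp4M h1 h1)))); last by lia.
set c := _`_ _; move=> H; have {}H := H ltac:(lia); lia.
Qed.

(** At [4m] all four squares have the same parity. Of the full coefficient, 24 times the divisor
    sum, the even squares take the representations of [m], which are 8 times the divisor sum. *)
Lemma coef_theta1_4 B (m : nat) : odd m -> (4 * m <= B.*2)%N ->
  (theta 1 B.*2 ^+ 4)`_(4 * m) = 16 * sigma B.*2 m%:Z.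
Proof.
move=> mo mB; have h0 := @supp4_theta 0 B.*2 isT; have h1 := @supp4_theta 1 B.*2 isT.
have := @coef_theta4 B.*2 (4 * m); rewrite dsum_chi_4odd //.
have -> : chi (4 * m)%N%:Z = 1 by rewrite /chi; lia.
have -> : theta_full B.*2 ^+ 4 = theta 0 B.*2 ^+ 4 +
   (theta 0 B.*2 * (theta 0 B.*2 * (theta 0 B.*2 * theta 1 B.*2))) *+ 4 +
   (theta 0 B.*2 * (theta 0 B.*2 * (theta 1 B.*2 * theta 1 B.*2))) *+ 6 +
   (theta 0 B.*2 * (theta 1 B.*2 * (theta 1 B.*2 * theta 1 B.*2))) *+ 4 +
   theta 1 B.*2 ^+ 4.
  by rewrite /theta_full; ring.
rewrite !coefD.
rewrite (supp4_coef0 (supp4M h0 (supp4M h0 (supp4M h0 h1)))); last by lia.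
rewrite (supp4_coef0 (supp4M h0 (supp4M h0 (supp4M h1 h1)))); last by lia.
rewrite (supp4_coef0 (supp4M h0 (supp4M h1 (supp4M h1 h1)))); last by lia.
have -> : (theta 0 B.*2 ^+ 4)`_(4 * m) = 8 * sigma B m%:Z.
  rewrite theta0_comp -rmorphXn /= coef_comp_poly_Xn // dvdn_mulr // mulKn //.
  rewrite coef_theta4 ?dsum_chi_odd //; last by lia.
  by have -> : chi m%:Z = -1 by [rewrite /chi; lia]; ring.
rewrite (@sigma_box B B.*2); [|lia|lia].
set c := _`_ _; move=> H; have {}H := H ltac:(lia); lia.
Qed.

(** * The three-square theorem *)

Lemma sg_cases (x : int) :
  [\/ 0 < x /\ Num.sg x = 1, x = 0 /\ Num.sg x = 0 | x < 0 /\ Num.sg x = -1].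
Proof.
case: (ltgtP x 0) => [x0|x0|->]; last by constructor 2; rewrite sgr0.
  by constructor 3; rewrite ltr0_sg.
by constructor 1; rewrite gtr0_sg.
Qed.

(* The addition formula of tanh, whose limit at infinity is the sign. *)
Lemma sg_mul (x y : int) : x + y != 0 ->
  Num.sg x * Num.sg y = Num.sg (x + y) * (Num.sg x + Num.sg y) - 1.
Proof.
by case: (sg_cases x) => -[? ->]; case: (sg_cases y) => -[? ->];
   case: (sg_cases (x + y)) => -[? ->]; lia.
Qed.

(** A nonzero weight forces [xz >= 0] and [yw >= 0], so it bounds the solutions of an equation
    [xz + yw = n]. For [w = x + z] the form is [xy + yz + zx]. *)
Definition kern (x y z w : int) : int :=
  (Num.sg x + Num.sg z) * (Num.sg y + Num.sg w).

(* By [sg_mul], [kern x y z (x + z)] is, up to the constant [-2], linear in the signs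
   of [x], [y], [z], with coefficients depending only on [x + y], [y + z], [x + z];
   and the shift leaves [x + y] and [y + z] unchanged. *)
Lemma kern_shift (s x y z : int) : x + y != 0 -> y + z != 0 ->
  kern (x + s) (y - s) (z + s) (x + z) = kern x y z (x + z)
  - (Num.sg y - Num.sg (y - s)) * (Num.sg (x + y) + Num.sg (y + z))
  + (Num.sg (x + s) - Num.sg x) * (Num.sg (x + y) + Num.sg (x + z))
  + (Num.sg (z + s) - Num.sg z) * (Num.sg (y + z) + Num.sg (x + z)).
Proof.
move=> xy yz.
have e1 : x + s + (y - s) = x + y by ring.
have e2 : y - s + (z + s) = y + z by ring.
have h1 := sg_mul xy; have h2 := sg_mul yz.
have := @sg_mul (x + s) (y - s); rewrite e1 => /(_ xy) h3.
have := @sg_mul (y - s) (z + s); rewrite e2 => /(_ yz) h4.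
rewrite /kern.
set p := Num.sg x; set q := Num.sg y; set r := Num.sg z.
set p' := Num.sg (x + s); set q' := Num.sg (y - s); set r' := Num.sg (z + s).
set u := Num.sg (x + z).
transitivity (p' * q' + q' * r' + (p' + r') * u); first by ring.
transitivity (p * q + q * r + (p + r) * u
  - (q - q') * (Num.sg (x + y) + Num.sg (y + z))
  + (p' - p) * (Num.sg (x + y) + u) + (r' - r) * (Num.sg (y + z) + u)); last by ring.
by rewrite h1 h2 h3 h4; ring.
Qed.

(** The value at [K = 0] vanishes by symmetry. Raising [K] by one changes a single term: [s = -K]
    from 0 to 1, or [s = -K - 1] from -1 to 0, whichever has parity [a]. Summing signs over [s] thus
    recovers a divisor. *)
Lemma sum_sg L (a K : int) : (a == 0) || (a == 1) -> `|K| <= L%:Z ->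
  \sum_(s <- irange L | (s %% 2)%Z == a) Num.sg (K + s) = K.
Proof.
move=> ha.
have opp (K' : int) : \sum_(s <- irange L | (s %% 2)%Z == a) Num.sg (- K' + s) =
    - \sum_(s <- irange L | (s %% 2)%Z == a) Num.sg (K' + s).
  rewrite -sumrN; rewrite (big_cond_bij (U := irange L)
    (P := fun s => (s %% 2)%Z == a) (fun s => Num.sg (- K' + s))
    (i := fun s => - s) (j := fun s => - s)) ?irange_uniq //.
  - by apply: eq_bigr => s _; rewrite -opprD sgrN.
  - by move=> s; rewrite !mem_irange; split; lia.
  by move=> s; rewrite !mem_irange; split; lia.
have H (k : nat) : (k <= L)%N ->
    \sum_(s <- irange L | (s %% 2)%Z == a) Num.sg (k%:Z + s) = k%:Z.
  elim: k => [|k IH] kL.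
    by have := opp 0; rewrite oppr0; set S := \sum_(s <- _ | _) _ => h; apply: (_ : S = 0); lia.
  apply/eqP; rewrite -subr_eq0 -[X in _ - X]/(k.+1%:Z).
  have -> : k.+1%:Z = k%:Z + 1 by lia.
  rewrite -{2}IH ?(ltnW kL) // opprD addrA -sumrB.
  pose r : int := if ((k%:Z %% 2)%Z == a) then - k%:Z else - k%:Z - 1.
  have r2 : (r %% 2)%Z == a by rewrite /r; case: ifP; lia.
  rewrite -big_filter (bigD1_seq r) ?filter_uniq ?irange_uniq //; last first.
    by rewrite mem_filter mem_irange r2 /r; case: ifP; lia.
  rewrite big_filter_cond big1 => [|s /andP[s2 sr]].
    rewrite /= addr0; move: r2; rewrite /r; case: ifP => _ _.
      by case: (sg_cases (k%:Z + 1 + - k%:Z)) => -[? ->];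
         case: (sg_cases (k%:Z + - k%:Z)) => -[? ->]; lia.
    by case: (sg_cases (k%:Z + 1 + (- k%:Z - 1))) => -[? ->];
       case: (sg_cases (k%:Z + (- k%:Z - 1))) => -[? ->]; lia.
  move: r2 sr; rewrite /r; case: ifP => ? ? ?;
  by case: (sg_cases (k%:Z + 1 + s)) => -[? ->];
     case: (sg_cases (k%:Z + s)) => -[? ->]; lia.
case: K => k; first by move=> h; apply: H; lia.
by rewrite NegzE opp => h; rewrite H; lia.
Qed.

(** The two factors have equal signs, so the weight is 2 or -2, and the oddness of [g] makes the
    negative pairs contribute as much as the positive ones. *)
Lemma sum_sg_pairs B (k : int) (g : int -> int -> int) : 0 < k ->
  (forall d e, g (- d) (- e) = - g d e) ->
  \sum_(p <- box2 B | p.1 * p.2 == k) (Num.sg p.1 + Num.sg p.2) * g p.1 p.2 =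
  4 * dsum B k g.
Proof.
move=> k0 gN; rewrite (bigID (fun p => 0 < p.1)) /=.
have -> : 4 * dsum B k g = 2 * dsum B k g + 2 * dsum B k g by ring.
rewrite {1 2}/dsum !mulr_sumr; congr (_ + _).
  apply: eq_big => [p|p /andP[/eqP E d0]]; first by nia.
  by have e0 : 0 < p.2 by [nia]; rewrite !gtr0_sg.
rewrite (big_cond_bij (U := box2 B)
    (P := fun p => [&& 0 < p.1, 0 < p.2 & p.1 * p.2 == k])
    (fun p => (Num.sg p.1 + Num.sg p.2) * g p.1 p.2)
    (i := fun p => (- p.1, - p.2)) (j := fun p => (- p.1, - p.2))) ?box2_uniq //.
- by apply: eq_bigr => p /and3P[d0 e0 _] /=; rewrite gN !sgrN !gtr0_sg //; ring.
- move=> [d e]; rewrite !mem_box2 /= => ? /and3P[d0 e0 /eqP E].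
  by rewrite mulrNN E !opprK eqxx; split=> //; lia.
move=> [d e]; rewrite !mem_box2 /= => ? /andP[/eqP E d0].
have e0 : e < 0 by nia.
by rewrite mulrNN E !opprK eqxx; split=> //; lia.
Qed.

(* [s], [x], [z] have parity [a], [y] has parity [b], and [n = 2cm] with [m] odd. *)
Definition parity_class (a b c : int) :=
  [\/ [/\ a = 0, b = 1 & c = 1], [/\ a = 1, b = 0 & c = 1]
    | [/\ a = 1, b = 1 & c = 2]].

Lemma norm_reflect_le (p u K M N : int) : `|p + u| <= K -> `|u| <= M ->
  K + 4 * M <= N -> `|- p - 2 * u| <= N.
Proof. by lia. Qed.

Lemma reflect_mod2 (p u a : int) : (p %% 2)%Z == a -> ((- p - 2 * u) %% 2)%Z == a.
Proof. by lia. Qed.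

Lemma factor_le (p q : int) : p != 0 -> q != 0 -> Num.sg p + Num.sg q != 0 ->
  [/\ 0 < p * q, `|p| <= p * q & `|q| <= p * q].
Proof.
move=> p0 q0; case: (sg_cases p) => -[hp ->]; case: (sg_cases q) => -[hq ->] // _;
  first [by lia | by split; nia].
Qed.

Lemma reflect_in_box (s x y z n L B : int) :
  `|x + s| <= n -> `|z + s| <= n -> `|y - s| <= n -> `|x + z| <= n ->
  0 < n -> `|s| <= L -> 2 * n <= L -> n + L * L + 4 * L <= B ->
  [&& `|s + x + z| <= L, `|- z| <= B, `|2 * s + x + z - y| <= B & `|- x| <= B].
Proof.
move=> bX bZ bY bK n0 sL nL; have : 0 <= L * L by rewrite -expr2 sqr_ge0.
by move: (L * L) => L2; lia.
Qed.

Lemma parity_reflect (s x y z a b : int) : (s %% 2)%Z == a -> (x %% 2)%Z == a ->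
  (y %% 2)%Z == b -> (z %% 2)%Z == a ->
  ((s + x + z) %% 2)%Z == a /\ ((2 * s + x + z - y) %% 2)%Z == b.
Proof. by lia. Qed.

Lemma parity_opp (x z a : int) : (x %% 2)%Z == a -> (z %% 2)%Z == a ->
  ((- z) %% 2)%Z == a /\ ((- x) %% 2)%Z == a.
Proof. by lia. Qed.

Lemma param_x_in_box (s u e m n L B : int) : `|s| <= L -> `|u| <= n ->
  `|e| <= m -> m <= n -> n + L * L + 4 * L <= B -> 2 * n <= L ->
  [&& `|- s| <= B, `|u + s| <= B & `|2 * e + s| <= B].
Proof.
have : 0 <= L * L by rewrite -expr2 sqr_ge0.
by move: (L * L) => L2; lia.
Qed.

Lemma param_y_in_box (s d e m n L B : int) : `|s| <= L -> `|d| <= m ->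
  `|e| <= m -> m <= n -> n + L * L + 4 * L <= B -> 2 * n <= L ->
  [&& `|2 * d - s| <= B, `|s| <= B & `|2 * e - s| <= B].
Proof.
have : 0 <= L * L by rewrite -expr2 sqr_ge0.
by move: (L * L) => L2; lia.
Qed.

Lemma norm_oppD_le (d e m n L : int) : `|d| <= m -> `|e| <= m -> m <= n ->
  0 < n -> 2 * n <= L -> `|- (d + e)| <= L.
Proof. by lia. Qed.

(** * Weighted solutions of [s^2 + xy + yz + zx = n] with fixed parities *)

Section ParityClass.
Variables (a b c : int) (m L B : nat).
Hypothesis abc : parity_class a b c.
Hypothesis m_odd : odd m.
Let n : int := 2 * c * m%:Z.

Definition box4 := pairs (irange L) (box3 B).

Definition pts (t : int * (int * int * int)) : bool :=
  let: (s, (x, y, z)) := t in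
  [&& (s %% 2)%Z == a, (x %% 2)%Z == a, (y %% 2)%Z == b, (z %% 2)%Z == a
    & s ^+ 2 + (x * y + y * z + z * x) == n].

Lemma box4_uniq : uniq box4.
Proof. by rewrite pairs_uniq ?irange_uniq ?box3_uniq. Qed.

Lemma mem_box4 s x y z : ((s, (x, y, z)) \in box4) =
  [&& `|s| <= L%:Z, `|x| <= B%:Z, `|y| <= B%:Z & `|z| <= B%:Z].
Proof. by rewrite mem_pairs mem_irange mem_box3. Qed.

(** Two variables of different parity have an odd sum. If two of equal parity cancelled, [n] would
    be a difference of two squares of equal parity, hence 0 modulo 4, or modulo 8 for odd squares;
    but [n = 2cm] is 2 modulo 4 or 4 modulo 8. *)
Lemma pts_neq0 s x y z : pts (s, (x, y, z)) ->
  [/\ x + y != 0, y + z != 0 & x + z != 0].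
Proof.
have key (u v w : int) : (s %% 2)%Z == a -> (u %% 2)%Z == (v %% 2)%Z ->
    (u %% 2)%Z == a \/ c = 2 ->
    s ^+ 2 + (u * v + v * w + w * u) == n -> u + v != 0.
  move=> hs uv ua /eqP E; apply/eqP => h0.
  have vE : v = - u by lia.
  have {}E : s ^+ 2 - u ^+ 2 = n by rewrite -E vE; ring.
  have [s' sE] := odd_evenP s; have [u' uE] := odd_evenP u.
  have [s'' sE'] := odd_evenP s'; have [u'' uE'] := odd_evenP u'.
  move: E; rewrite /n.
  case: abc => -[a0 b0 c0]; case: sE => sE; case: uE => uE; case: sE' => sE';
  case: uE' => uE'; move: hs ua; rewrite c0 a0 sE uE sE' uE' !expr2; lia.
move=> /and5P[hs hx hy hz E].
have E1 : s ^+ 2 + (y * z + z * x + x * y) == n.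
  by rewrite -(eqP E); apply/eqP; ring.
have E2 : s ^+ 2 + (x * z + z * y + y * x) == n.
  by rewrite -(eqP E); apply/eqP; ring.
split.
- case: abc => -[a0 b0 c0]; try by lia.
  by apply: (key _ _ z) => //; [lia | right].
- case: abc => -[a0 b0 c0]; try by lia.
  by apply: (key _ _ x) => //; [lia | right].
by apply: (key _ _ y) => //; [lia | left].
Qed.

(** These two bounds keep the involutions inside [box4]: the new value of [s] in [sum_generic] has
    size at most [2n], and [n + L^2] bounds the factors of [n - s^2 + u^2] when [s] and [u] are at
    most [L] in size. *)
Hypothesis L_large : 2 * n <= L%:Z.
Hypothesis B_large : n + L%:Z * L%:Z + 4 * L%:Z <= B%:Z.

Lemma n_gt0 : 0 < n.
Proof. by rewrite /n; case: abc => -[_ _ ->]; lia. Qed.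

Lemma norm_le_mul (p q : int) : q != 0 -> `|p| <= `|p * q|.
Proof. by move=> q0; rewrite normrM ler_peMr //; lia. Qed.

Lemma norm_factors_le (u s p q : int) : `|u| <= L%:Z -> `|s| <= L%:Z ->
  p != 0 -> q != 0 -> p * q = n - s ^+ 2 + u ^+ 2 ->
  `|p| <= n + L%:Z * L%:Z /\ `|q| <= n + L%:Z * L%:Z.
Proof.
move=> hu hs p0 q0 E.
have u2 : 0 <= u ^+ 2 <= L%:Z * L%:Z.
  by rewrite sqr_ge0 -[_ ^+ 2]real_normK ?num_real // expr2 ler_pM.
have s2 : 0 <= s ^+ 2 <= L%:Z * L%:Z.
  by rewrite sqr_ge0 -[_ ^+ 2]real_normK ?num_real // expr2 ler_pM.
have := n_gt0; have := norm_le_mul p q0; have := norm_le_mul q p0.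
by rewrite mulrC E; lia.
Qed.

Lemma sg_shift_le (s u : int) : Num.sg u != Num.sg (u - s) -> `|u| <= `|s|.
Proof.
by case: (sg_cases u) => -[? ->]; case: (sg_cases (u - s)) => -[? ->] //; lia.
Qed.

(** The form equals [s^2 + (x + y)(y + z) - y^2], so negating both [x + y] and [y + z] at fixed [s]
    and [y] preserves it and the parities. The first factor of the summand vanishes unless
    [|y| <= |s|], which keeps the reflection in the box. *)
Lemma sum_shift_y : \sum_(t <- box4 | pts t) (let: (s, (x, y, z)) := t in
  (Num.sg y - Num.sg (y - s)) * (Num.sg (x + y) + Num.sg (y + z))) = 0.
Proof.
apply: (big_antisym (i := fun t => let: (s, (x, y, z)) := t in
  (s, (- x - 2 * y, y, - z - 2 * y)))); first exact: box4_uniq.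
move=> [s [[x y] z]] tU Pt; rewrite mulf_eq0 negb_or => /andP[h1 _].
have [xy yz xz] := pts_neq0 Pt; have n0 := n_gt0.
move: tU; rewrite mem_box4 => /and4P[sL xB yB zB].
have ys : `|y| <= `|s| by apply: sg_shift_le; move: h1; rewrite subr_eq0.
have /and5P[hs hx hy hz /eqP E] := Pt.
have [] := @norm_factors_le y s (x + y) (y + z) (le_trans ys sL) sL xy yz.
  by rewrite -E; ring.
move=> b1 b2; split.
- have ys' := le_trans ys sL.
  rewrite mem_box4 sL yB (norm_reflect_le b1 ys' B_large).
  by rewrite (norm_reflect_le (M := L%:Z) _ ys' B_large) // addrC.
- by rewrite /= hs hy !reflect_mod2 //= -E; apply/eqP; ring.
- by congr (_, (_, _, _)); ring.
have -> : - x - 2 * y + y = - (x + y) by ring.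
have -> : y + (- z - 2 * y) = - (y + z) by ring.
by rewrite !sgrN; ring.
Qed.

Lemma sum_shift_x : \sum_(t <- box4 | pts t) (let: (s, (x, y, z)) := t in
  (Num.sg (x + s) - Num.sg x) * (Num.sg (x + y) + Num.sg (x + z))) = 0.
Proof.
apply: (big_antisym (i := fun t => let: (s, (x, y, z)) := t in
  (s, (x, - y - 2 * x, - z - 2 * x)))); first exact: box4_uniq.
move=> [s [[x y] z]] tU Pt; rewrite mulf_eq0 negb_or => /andP[h1 _].
have [xy yz xz] := pts_neq0 Pt; have n0 := n_gt0.
move: tU; rewrite mem_box4 => /and4P[sL xB yB zB].
have xs : `|x| <= `|s|.
  rewrite -[`|s|]normrN; apply: sg_shift_le.
  by rewrite opprK eq_sym; move: h1; rewrite subr_eq0.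
have /and5P[hs hx hy hz /eqP E] := Pt.
have [] := @norm_factors_le x s (x + y) (x + z) (le_trans xs sL) sL xy xz.
  by rewrite -E; ring.
move=> b1 b2; split.
- have xs' := le_trans xs sL; rewrite addrC in b1; rewrite addrC in b2.
  by rewrite mem_box4 sL xB (norm_reflect_le b1 xs' B_large)
    (norm_reflect_le b2 xs' B_large).
- by rewrite /= hs hx !reflect_mod2 //= -E; apply/eqP; ring.
- by congr (_, (_, _, _)); ring.
have -> : x + (- y - 2 * x) = - (x + y) by ring.
have -> : x + (- z - 2 * x) = - (x + z) by ring.
by rewrite !sgrN; ring.
Qed.

Lemma big_swap_xz (f : int * (int * int * int) -> int) (Q : pred (int * (int * int * int))) :
  \sum_(t <- box4 | pts t && Q t) f t =
  \sum_(t <- box4 | pts t && Q (let: (s, (x, y, z)) := t in (s, (z, y, x))))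
     f (let: (s, (x, y, z)) := t in (s, (z, y, x))).
Proof.
have sw s x y z : pts (s, (x, y, z)) -> pts (s, (z, y, x)).
  move=> /and5P[hs hx hy hz /eqP E]; rewrite /pts -E.
  by apply/and5P; split=> //; apply/eqP; ring.
apply: (big_cond_bij f (j := fun t => let: (s, (x, y, z)) := t in (s, (z, y, x))));
  rewrite ?box4_uniq // => -[s [[x y] z]]; rewrite !mem_box4 => H /andP[/sw Pt HQ].
  by split; rewrite ?Pt // ; lia.
by split; rewrite ?Pt // ; lia.
Qed.

Lemma sum_shift_z : \sum_(t <- box4 | pts t) (let: (s, (x, y, z)) := t in
  (Num.sg (z + s) - Num.sg z) * (Num.sg (y + z) + Num.sg (x + z))) = 0.
Proof.
have := big_swap_xz (fun t => let: (s, (x, y, z)) := t in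
  (Num.sg (z + s) - Num.sg z) * (Num.sg (y + z) + Num.sg (x + z))) xpredT.
rewrite (eq_bigl pts) => [->|t]; last by rewrite andbT.
rewrite (eq_bigl pts) => [|t]; last by rewrite andbT.
rewrite -[RHS]sum_shift_x; apply: eq_bigr => -[s [[x y] z]] _.
by rewrite (addrC y x) (addrC z x).
Qed.

Lemma sum_kern_shift :
  \sum_(t <- box4 | pts t) (let: (s, (x, y, z)) := t in kern x y z (x + z)) =
  \sum_(t <- box4 | pts t) (let: (s, (x, y, z)) := t in
    kern (x + s) (y - s) (z + s) (x + z)).
Proof.
rewrite [RHS](eq_bigr (fun t => (let: (s, (x, y, z)) := t in kern x y z (x + z))
  - (let: (s, (x, y, z)) := t in
      (Num.sg y - Num.sg (y - s)) * (Num.sg (x + y) + Num.sg (y + z)))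
  + (let: (s, (x, y, z)) := t in
      (Num.sg (x + s) - Num.sg x) * (Num.sg (x + y) + Num.sg (x + z)))
  + (let: (s, (x, y, z)) := t in
      (Num.sg (z + s) - Num.sg z) * (Num.sg (y + z) + Num.sg (x + z))))).
  by rewrite !big_split /= sumrN sum_shift_x sum_shift_y sum_shift_z oppr0 !addr0.
by move=> [s [[x y] z]] /pts_neq0[xy yz xz]; rewrite kern_shift.
Qed.

Definition shifted_kern (t : int * (int * int * int)) : int :=
  let: (s, (x, y, z)) := t in kern (x + s) (y - s) (z + s) (x + z).

Lemma m_le_n : m%:Z <= n.
Proof. by rewrite /n; case: abc => -[_ _ ->]; lia. Qed.

Lemma n_le_B : n <= B%:Z.
Proof.
have : 0 <= L%:Z * L%:Z by rewrite -expr2 sqr_ge0.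
by move: B_large; move: (L%:Z * L%:Z) n => u k; lia.
Qed.

Lemma c_mul_le_n (d : int) : `|d| <= m%:Z -> `|c * d| <= n.
Proof. by rewrite /n; case: abc => -[_ _ ->]; lia. Qed.

Lemma n_mul_le (X Y Z K : int) : X * Z + Y * K = n ->
  Num.sg X + Num.sg Z != 0 -> Num.sg Y + Num.sg K != 0 ->
  X != 0 -> Z != 0 -> Y != 0 -> K != 0 ->
  [/\ `|X| <= n, `|Z| <= n, `|Y| <= n & `|K| <= n].
Proof.
move=> E XZ YK X0 Z0 Y0 K0.
have [] := (factor_le X0 Z0 XZ, factor_le Y0 K0 YK).
by move: E; move: (X * Z) (Y * K) n => u v k E [? ? ?] [? ? ?]; split; lia.
Qed.

(* In the coordinates [X = x + s], [Z = z + s], [Y = y - s], [K = x + z], where the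
   equation is [XZ + YK = n], the involution maps [(Y, K)] to [(-Y, -K)]. *)
Lemma sum_generic : \sum_(t <- box4 | pts t &&
    (let: (s, (x, y, z)) := t in [&& x + s != 0, z + s != 0 & y - s != 0]))
  shifted_kern t = 0.
Proof.
apply: (big_antisym (i := fun t => let: (s, (x, y, z)) := t in
  (s + x + z, (- z, 2 * s + x + z - y, - x)))); first exact: box4_uniq.
move=> [s [[x y] z]] tU /andP[Pt /and3P[X0 Z0 Y0]].
have [_ _ K0] := pts_neq0 Pt.
rewrite /shifted_kern /kern mulf_eq0 negb_or => /andP[XZ YK].
have /and5P[hs hx hy hz /eqP E] := Pt.
have {}E : (x + s) * (z + s) + (y - s) * (x + z) = n by rewrite -E; ring.
have [bX bZ bY bK] := n_mul_le E XZ YK X0 Z0 Y0 K0.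
have Y0' : 2 * s + x + z - y - (s + x + z) != 0.
  by have -> : 2 * s + x + z - y - (s + x + z) = - (y - s) by [ring]; rewrite oppr_eq0.
have X0' : - z + (s + x + z) != 0 by have -> : - z + (s + x + z) = x + s by ring.
have Z0' : - x + (s + x + z) != 0 by have -> : - x + (s + x + z) = z + s by ring.
have [p1 p2] := parity_reflect hs hx hy hz.
split.
- move: tU; rewrite !mem_box4 => /and4P[sL _ _ _].
  exact: (reflect_in_box bX bZ bY bK n_gt0 sL L_large B_large).
- rewrite X0' Z0' Y0' !andbT /= p1 p2 -E; have [-> ->] := parity_opp hx hz.
  by apply/eqP; ring.
- by congr (_, (_, _, _)); ring.
have -> : - z + (s + x + z) = x + s by ring.
have -> : - x + (s + x + z) = z + s by ring.
have -> : 2 * s + x + z - y - (s + x + z) = - (y - s) by ring.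
have -> : - z - x = - (x + z) by ring.
by rewrite !sgrN; ring.
Qed.

Lemma odd_factors (d e : int) : d * e = m%:Z ->
  [/\ (d %% 2)%Z = 1, (e %% 2)%Z = 1, `|d| <= m%:Z & `|e| <= m%:Z].
Proof.
move=> E.
have d0 : d != 0 by apply: contraTneq m_odd => d0; move: E; rewrite d0 mul0r; lia.
have e0 : e != 0 by apply: contraTneq m_odd => e0; move: E; rewrite e0 mulr0; lia.
have hd := norm_le_mul d e0; have he := norm_le_mul e d0; rewrite mulrC in he.
rewrite E in hd he.
have [d' dE] := odd_evenP d; have [e' eE] := odd_evenP e.
move: E; case: dE => dE; case: eE => eE; rewrite dE eE => E; try by lia.
by rewrite -dE -eE; split; lia.
Qed.

Lemma ac_cases : (a == 0) || (a == 1).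
Proof. by case: abc => -[-> _ _]. Qed.

Lemma c_neq0 : 2 * c != 0.
Proof. by case: abc => -[_ _ ->]. Qed.

(** On each boundary [XYZ = 0] the equation becomes a factorization of [m] with [s] left free; the
    sum over [s] is then evaluated by [sum_sg]. *)
Lemma sum_pairs_sg (F : int * int -> int) :
  (forall p, p.1 * p.2 = m%:Z -> `|F p| <= L%:Z) ->
  \sum_(t <- pairs (irange L) (box2 B) | ((t.1 %% 2)%Z == a) && (t.2.1 * t.2.2 == m%:Z))
    (Num.sg t.2.1 + Num.sg t.2.2) * Num.sg (F t.2 + t.1) =
  \sum_(p <- box2 B | p.1 * p.2 == m%:Z) (Num.sg p.1 + Num.sg p.2) * F p.
Proof.
move=> FL; rewrite (big_pairs _ _
  (fun s (p : int * int) => ((s %% 2)%Z == a) && (p.1 * p.2 == m%:Z))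
  (fun s (p : int * int) => (Num.sg p.1 + Num.sg p.2) * Num.sg (F p + s))).
rewrite (eq_bigr (fun s => \sum_(p <- box2 B | p.1 * p.2 == m%:Z)
   (if (s %% 2)%Z == a then
   (Num.sg p.1 + Num.sg p.2) * Num.sg (F p + s) else 0))); last first.
  move=> s _; rewrite big_mkcond [RHS]big_mkcond; apply: eq_bigr => p _.
  by case: eqP; case: eqP.
rewrite exchange_big /=; apply: eq_bigr => p /eqP hp.
by rewrite -big_mkcond -mulr_sumr sum_sg ?ac_cases ?FL.
Qed.

(** For [x = -s] the equation is [(y - s)(x + z) = 2cm], and the parities allow [y - s = cd] and
    [x + z = 2e] with [de = m]. The weight is [(sg d + sg e) sg (e + s)], whose sum over [s] leaves
    [e]. *)
Lemma sum_x_eq : \sum_(t <- box4 | pts t &&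
    (let: (s, (x, y, z)) := t in x + s == 0)) shifted_kern t = 4 * sigma B m%:Z.
Proof.
have m0 : 0 < m%:Z by lia.
rewrite /sigma dsumC -(sum_sg_pairs B m0 (g := fun _ e => e)) //.
rewrite -(sum_pairs_sg (F := fun p => p.2)); last first.
  move=> p /odd_factors[_ _ _ h]; apply: (le_trans h); apply: (le_trans m_le_n).
  by have := n_gt0; move: L_large; lia.
rewrite (big_cond_bij (U := pairs (irange L) (box2 B))
  (P := fun t => ((t.1 %% 2)%Z == a) && (t.2.1 * t.2.2 == m%:Z)) _
  (i := fun t => (t.1, (- t.1, c * t.2.1 + t.1, 2 * t.2.2 + t.1)))
  (j := fun t => let: (s, (x, y, z)) := t in (s, (((y - s) %/ c)%Z, ((x + z) %/ 2)%Z))));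
  rewrite ?box4_uniq ?pairs_uniq ?irange_uniq ?box2_uniq //.
- apply: eq_bigr => -[s [d e]] _; rewrite /shifted_kern /kern /=.
  have -> : - s + s = 0 by ring.
  have -> : c * d + s - s = c * d by ring.
  have -> : 2 * e + s + s = 2 * (e + s) by ring.
  have -> : - s + (2 * e + s) = 2 * e by ring.
  rewrite sgr0 !sgrM; have -> : Num.sg c = 1 by case: abc => -[_ _ ->].
  by rewrite (_ : Num.sg 2 = 1) //; ring.
- move=> [s [d e]]; rewrite mem_pairs mem_irange /= => /andP[sL _] /andP[hs /eqP E].
  have [d1 e1 dm em] := odd_factors E.
  split; first by rewrite mem_box4 sL; apply: (param_x_in_box sL (c_mul_le_n dm) em m_le_n B_large L_large).
     rewrite addNr eqxx andbT hs /n -E; apply/and5P; split=> //; try by lia.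
       by move: hs; case: abc => -[-> -> ->]; lia.
  congr (_, (_, _)).
    by rewrite addrK mulKz //; case: abc => -[_ _ ->].
  by lia.
move=> [s [[x y] z]]; rewrite mem_box4 => /and4P[sL xB yB zB] /andP[Pt /eqP X0].
have /and5P[hs hx hy hz /eqP E] := Pt.
have [k1 k2] : ((x + z) %/ 2)%Z * 2 = x + z /\ ((y - s) %/ c)%Z * c = y - s.
  by move: hs hx hy hz; case: abc => -[-> -> ->]; lia.
set d := ((y - s) %/ c)%Z in k2 *; set e := ((x + z) %/ 2)%Z in k1 *.
have de : d * e = m%:Z.
  apply: (mulfI c_neq0); rewrite -[RHS]E.
  transitivity ((d * c) * (e * 2)); first by ring.
  by rewrite k1 k2 (eqP (etrans (esym (addr_eq0 x s)) (introT eqP X0))); ring.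
have [d1 e1 dm em] := odd_factors de.
split; last by rewrite /=; congr (_, (_, _, _)); clear -k1 k2 X0; lia.
  rewrite mem_pairs mem_irange sL mem_box2 /=.
  have mB := le_trans m_le_n n_le_B.
  by rewrite (le_trans dm mB) (le_trans em mB).
by rewrite /= hs de eqxx.
Qed.

(** The mirror image of [sum_x_eq]; the points with both [x + s = 0] and [z + s = 0] have weight
    zero, so excluding them costs nothing. *)
Lemma sum_z_eq : \sum_(t <- box4 | pts t &&
    (let: (s, (x, y, z)) := t in (x + s != 0) && (z + s == 0))) shifted_kern t =
  4 * sigma B m%:Z.
Proof.
rewrite big_swap_xz -sum_x_eq.
rewrite [RHS](bigID (fun t => let: (s, (x, y, z)) := t in z + s == 0)) /=.
rewrite [X in _ = X + _]big1 ?add0r; last first.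
  move=> [s [[x y] z]] /andP[/andP[_ /eqP X0] /eqP Z0].
  by rewrite /shifted_kern /kern X0 Z0 sgr0 addr0 mul0r.
apply: eq_big => [[s [[x y] z]]|[s [[x y] z]] _] /=.
  by rewrite [LHS]andbA [LHS]andbAC.
by rewrite /shifted_kern /kern (addrC z x) [_ + Num.sg (x + s)]addrC.
Qed.

(** The equality [y = s] requires [a = b], hence [c = 2]. Then [x + s = 2d] and [z + s = 2e] with
    [de = m], and the sum over [s] leaves [d + e], that is, twice a divisor sum. *)
Lemma sum_y_eq : \sum_(t <- box4 | pts t &&
    (let: (s, (x, y, z)) := t in [&& x + s != 0, z + s != 0 & y - s == 0]))
    shifted_kern t = 8 * (c - 1) * sigma B m%:Z.
Proof.
have [c1|[a1 b1 c2]] : c = 1 \/ [/\ a = 1, b = 1 & c = 2].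
- by case: abc => -[? ? ?]; [left | left | right].
- rewrite c1 subrr mulr0 mul0r big_pred0 // => -[s [[x y] z]].
  apply/negP => /andP[/and5P[hs _ hy _ _] /and3P[_ _ Y0]].
  by move: hs hy; case: abc => -[-> -> c1']; lia.
have m0 : 0 < m%:Z by lia.
have -> : 8 * (c - 1) * sigma B m%:Z = 4 * dsum B m%:Z (fun d e => d + e).
  rewrite /dsum big_split /= -/(dsum B m%:Z (fun d _ => d)).
  by rewrite -/(dsum B m%:Z (fun _ e => e)) (dsumC B _ (fun _ e => e)) c2 /sigma; ring.
rewrite -(sum_sg_pairs B m0 (g := fun d e => d + e)); last by move=> d e; ring.
transitivity (- \sum_(p <- box2 B | p.1 * p.2 == m%:Z)
   (Num.sg p.1 + Num.sg p.2) * - (p.1 + p.2)); last first.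
  by rewrite -sumrN; apply: eq_bigr => p _; ring.
rewrite -(sum_pairs_sg (F := fun p => - (p.1 + p.2))); last first.
  move=> p /odd_factors[_ _ h1 h2].
  exact: norm_oppD_le h1 h2 m_le_n n_gt0 L_large.
rewrite -sumrN (big_cond_bij (U := pairs (irange L) (box2 B))
  (P := fun t => ((t.1 %% 2)%Z == a) && (t.2.1 * t.2.2 == m%:Z)) _
  (i := fun t => (t.1, (2 * t.2.1 - t.1, t.1, 2 * t.2.2 - t.1)))
  (j := fun t => let: (s, (x, y, z)) := t in
     (s, (((x + s) %/ 2)%Z, ((z + s) %/ 2)%Z))));
  rewrite ?box4_uniq ?pairs_uniq ?irange_uniq ?box2_uniq //.
- apply: eq_bigr => -[s [d e]] _; rewrite /shifted_kern /kern /=.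
  rewrite subrr !subrK sgr0 add0r !sgrM (_ : Num.sg 2 = 1) // !mul1r.
  have -> : 2 * d - s + (2 * e - s) = 2 * - (- (d + e) + s) by ring.
  by rewrite sgrM sgrN (_ : Num.sg 2 = 1) //; ring.
- move=> [s [d e]]; rewrite mem_pairs mem_irange /= => /andP[sL _] /andP[hs /eqP E].
  have [d1 e1 dm em] := odd_factors E.
  split; first by rewrite mem_box4 sL; apply: (param_y_in_box sL dm em m_le_n B_large L_large).
    rewrite !subrK subrr eqxx; apply/andP; split; last by clear -d1 e1; lia.
    apply/and5P; split; try by clear -hs d1 e1 a1 b1; lia.
    by apply/eqP; rewrite /n -E c2; ring.
  by congr (_, (_, _)); rewrite subrK; lia.
move=> [s [[x y] z]]; rewrite mem_box4 => /and4P[sL xB yB zB] /andP[Pt /and3P[_ _ /eqP Y0]].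
have /and5P[hs hx hy hz /eqP E] := Pt.
have [k1 k2] : ((x + s) %/ 2)%Z * 2 = x + s /\ ((z + s) %/ 2)%Z * 2 = z + s.
  by move: hs hx hy hz; rewrite a1; lia.
set d := ((x + s) %/ 2)%Z in k1 *; set e := ((z + s) %/ 2)%Z in k2 *.
have de : d * e = m%:Z.
  apply: (mulfI c_neq0); rewrite -[RHS]E c2.
  transitivity ((d * 2) * (e * 2)); first by ring.
  by rewrite k1 k2; have -> : y = s by [lia]; ring.
have [d1 e1 dm em] := odd_factors de.
split; last by rewrite /=; congr (_, (_, _, _)); clear -k1 k2 Y0; lia.
  rewrite mem_pairs mem_irange sL mem_box2 /=.
  have mB := le_trans m_le_n n_le_B.
  by rewrite (le_trans dm mB) (le_trans em mB).
by rewrite /= hs de eqxx.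
Qed.

Lemma sum_kern : \sum_(t <- box4 | pts t)
  (let: (s, (x, y, z)) := t in kern x y z (x + z)) = 8 * c * sigma B m%:Z.
Proof.
rewrite sum_kern_shift -/shifted_kern.
rewrite (bigID (fun t => let: (s, (x, y, z)) := t in x + s == 0)) /= sum_x_eq.
rewrite (bigID (fun t => let: (s, (x, y, z)) := t in z + s == 0)) /=.
rewrite [X in _ + (X + _)](_ : _ = 4 * sigma B m%:Z); last first.
  rewrite -sum_z_eq; apply: eq_bigl => -[s [[x y] z]] /=.
  by rewrite [RHS]andbA.
rewrite (bigID (fun t => let: (s, (x, y, z)) := t in y - s == 0)) /=.
rewrite [X in _ + (_ + (X + _))](_ : _ = 8 * (c - 1) * sigma B m%:Z); last first.
  rewrite -sum_y_eq; apply: eq_bigl => -[s [[x y] z]] /=.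
  by rewrite [RHS]andbA [RHS]andbA.
rewrite [X in _ + (_ + (_ + X))](_ : _ = 0); first by ring.
by rewrite -[RHS]sum_generic; apply: eq_bigl => -[s [[x y] z]] /=; rewrite [RHS]andbA [RHS]andbA.
Qed.

End ParityClass.

(** If the first factor is nonzero it has the sign of [x + z], and the second factor then has this
    sign or vanishes. *)
Lemma kern_ge0 (x y z : int) : 0 <= kern x y z (x + z).
Proof.
rewrite /kern; case: (sg_cases x) => -[? ->]; case: (sg_cases y) => -[? ->];
case: (sg_cases z) => -[? ->]; case: (sg_cases (x + z)) => -[? ->] //; lia.
Qed.

Lemma kern_supp (x y z : int) : kern x y z (x + z) != 0 ->
  0 <= x * y + y * z + z * x.
Proof.
rewrite /kern; case: (sg_cases x) => -[hx ->]; case: (sg_cases y) => -[hy ->];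
case: (sg_cases z) => -[hz ->]; case: (sg_cases (x + z)) => -[hxz ->] //;
  first [by lia | by nia].
Qed.

(** * Comparison of the weighted count with sums of three squares *)

Definition kern_count (a b : int) B (k : int) : int :=
  \sum_(p <- box3 B | let: (x, y, z) := p in
     [&& (x %% 2)%Z == a, (y %% 2)%Z == b, (z %% 2)%Z == a
       & x * y + y * z + z * x == k])
   (let: (x, y, z) := p in kern x y z (x + z)).

Lemma kern_count_lt0 a b B k : k < 0 -> kern_count a b B k = 0.
Proof.
move=> k0; apply: big1 => -[[x y] z] /and4P[_ _ _ /eqP E].
by apply/eqP; apply: contraTT k0 => /kern_supp; rewrite E -leNgt.
Qed.

Lemma sum_kern_count a b c m L B :
  \sum_(t <- box4 L B | pts a b c m t)
     (let: (s, (x, y, z)) := t in kern x y z (x + z)) =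
  \sum_(s <- irange L | (s %% 2)%Z == a) kern_count a b B (2 * c * m%:Z - s ^+ 2).
Proof.
pose P (s : int) (p : int * int * int) := let: (x, y, z) := p in
  [&& (s %% 2)%Z == a, (x %% 2)%Z == a, (y %% 2)%Z == b, (z %% 2)%Z == a
    & s ^+ 2 + (x * y + y * z + z * x) == 2 * c * m%:Z].
pose f (s : int) (p : int * int * int) := let: (x, y, z) := p in kern x y z (x + z).
transitivity (\sum_(t <- box4 L B | P t.1 t.2) f t.1 t.2).
  by apply: eq_big => -[s [[x y] z]].
rewrite (big_pairs _ _ P f) [RHS]big_mkcond; apply: eq_bigr => s _.
case: ifP => sa; last by rewrite big_pred0 // => -[[x y] z]; rewrite /P sa.
apply: eq_bigl => -[[x y] z]; rewrite /P sa /=.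
by congr [&& _, _, _ & _]; apply/eqP/eqP => [<-|->]; ring.
Qed.

(** The factor [3 - c], which is 2 or 1, brings the three classes to the common value found in
    [sum_kern]. *)
Lemma coef_theta_class a b c (m L n : nat) : parity_class a b c -> odd m ->
  n%:Z = 2 * c * m%:Z -> (n <= L.*2)%N ->
  (3 - c) * (theta a L.*2 ^+ 2 * theta b L.*2 ^+ 2)`_n = 8 * c * sigma L.*2 m%:Z.
Proof.
move=> abc mo nE nL; case: abc => -[-> -> cE].
- have nm : n = (2 * m)%N by move: nE; rewrite cE; lia.
  by rewrite nm coef_theta22 -?nm // cE; ring.
- have nm : n = (2 * m)%N by move: nE; rewrite cE; lia.
  by rewrite nm mulrC [theta 1 _ ^+ 2 * _]mulrC coef_theta22 -?nm // cE; ring.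
have nm : n = (4 * m)%N by move: nE; rewrite cE; lia.
by rewrite nm -exprD coef_theta1_4 -?nm // cE; ring.
Qed.

(** In each class [s^2 - a] is a multiple of [4c], so subtracting it from [2cm] lowers [m] by an
    even number. *)
Lemma class_step (a b c s m k n : int) : parity_class a b c -> (s %% 2)%Z = a ->
  (m %% 2)%Z = 1 -> n = 2 * c * m -> k = n - s ^+ 2 -> 0 <= k ->
  a < s ^+ 2 ->
  exists m' : nat, [/\ odd m', k + a = 2 * c * m'%:Z & m'%:Z < m].
Proof.
move=> abc sa mo nE kE k0 as2; exists (absz ((k + a) %/ (2 * c))%Z).
have [t tE] := odd_evenP s; have [u uE] := odd_evenP t.
rewrite nE in kE.
by case: abc => -[aE bE cE]; rewrite aE cE in kE as2 sa *; case: tE => tE;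
  case: uE => uE; rewrite tE uE expr2 in kE as2 sa; rewrite kE; split; lia.
Qed.

(* Both sides have the same sum over [k = n - s^2], and the smallest [s] isolates the
   term of the largest [k]. *)
Lemma kern_count_coef a b c L B (m k : nat) : parity_class a b c -> odd m ->
  k%:Z + a = 2 * c * m%:Z -> 2 * (2 * c * m%:Z) <= L.*2%:Z ->
  2 * c * m%:Z + L.*2%:Z * L.*2%:Z + 4 * L.*2%:Z <= B%:Z ->
  kern_count a b B k%:Z =
  (3 - c) * (theta a L.*2 * theta b L.*2 ^+ 2)`_k.
Proof.
move=> abc; have [M] := ubnP m; elim: M m k => // M IH m k mM mo kE hL hB.
set R := theta a L.*2 * theta b L.*2 ^+ 2.
pose n := absz (2 * c * m%:Z)%R.
have c0 : 0 < c by case: abc => -[_ _ ->].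
have cm0 : 0 < 2 * c * m%:Z by rewrite !mulr_gt0 //; lia.
have nE : n%:Z = 2 * c * m%:Z by rewrite /n; lia.
have mn : m%:Z <= n%:Z by rewrite nE; case: abc => -[_ _ ->]; lia.
have nL : (n <= L.*2)%N by rewrite nE in mn *; lia.
have LB : L.*2%:Z <= B%:Z.
  have : 0 <= L.*2%:Z * L.*2%:Z by rewrite -expr2 sqr_ge0.
  by move: hB; rewrite -nE; move: (_ * _) => u; lia.
have := sum_kern abc mo hL hB; rewrite sum_kern_count -nE.
rewrite (@sigma_box B L.*2); try by lia.
rewrite -(coef_theta_class abc mo nE nL).
have -> : theta a L.*2 ^+ 2 * theta b L.*2 ^+ 2 = theta a L.*2 * R.
  by rewrite /R; ring.
rewrite coef_thetaM mulr_sumr big_mkcondr => /eqP; rewrite -subr_eq0 -sumrB.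
(* The smallest squares, [s^2 = a], all give the index [k]; every other [s] gives a smaller index,
   where the two counts agree by induction, or a negative one. *)
rewrite (eq_bigr (fun s => (if s ^+ 2 == a then 1 else 0) *
   (kern_count a b B k%:Z - (3 - c) * R`_k))); last first.
  move=> s /eqP sa; have [s2|s2] := eqVneq (s ^+ 2) a.
    have -> : n%:Z - s ^+ 2 = k%:Z by rewrite s2 nE -kE; ring.
    have -> : (absz s ^ 2 <= n)%N.
      by have : k%:Z = n%:Z - s ^+ 2 by [rewrite s2 nE -kE; ring]; lia.
    have -> : (n - absz s ^ 2)%N = k.
      by have : k%:Z = n%:Z - s ^+ 2 by [rewrite s2 nE -kE; ring]; lia.
    by rewrite mul1r.
  rewrite mul0r; case: ifP => sn; last by rewrite kern_count_lt0 ?subr0 //; lia.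
  have as2 : a < s ^+ 2.
    have : 0 <= s ^+ 2 by rewrite sqr_ge0.
    have := ac_cases abc; case: (eqVneq s 0) => [s0|s0]; last by lia.
    by move: sa s2; rewrite s0 expr0n /=; lia.
  have m2 : (m%:Z %% 2)%Z = 1 by lia.
  have k0 : 0 <= n%:Z - s ^+ 2 by lia.
  have [m' [mo' kE' mm']] := class_step abc sa m2 nE erefl k0 as2.
  have kE'' : (n - absz s ^ 2)%N%:Z = n%:Z - s ^+ 2 by lia.
  have cmm : 2 * c * m'%:Z <= 2 * c * m%:Z by rewrite ler_pM2l; lia.
  apply/eqP; rewrite subr_eq0 -kE''; apply/eqP; apply: (IH m') => //.
  - by lia.
  - by rewrite kE''.
  - by apply: le_trans hL; lia.
  by apply: le_trans hB; rewrite -!addrA lerD2r.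
rewrite -mulr_suml mulf_eq0 => /orP[|]; last by rewrite subr_eq0 => /eqP.
(* The number of [s] with [s^2 = a] is positive, since [s = a] is one of them. *)
rewrite -big_mkcondr /= -big_filter => /eqP H; exfalso; move: H; apply/eqP.
rewrite lt0r_neq0 // (bigD1_seq a) ?filter_uniq ?irange_uniq //.
  by rewrite ltr_pwDl // sumr_ge0.
by rewrite mem_filter mem_irange; case: abc => -[-> _ cE] /=; lia.
Qed.

(** As no weight is negative, one solution of nonzero weight makes the count nonzero, and with it a
    coefficient of a product of three theta series. *)
Lemma three_squares_class a b c (k m : nat) (x y z : int) : parity_class a b c ->
  odd m -> k%:Z + a = 2 * c * m%:Z ->
  [/\ (x %% 2)%Z = a, (y %% 2)%Z = b & (z %% 2)%Z = a] ->
  x * y + y * z + z * x = k%:Z -> kern x y z (x + z) != 0 ->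
  [/\ `|x| <= k%:Z, `|y| <= k%:Z & `|z| <= k%:Z] ->
  exists u v w : int, k%:Z = u ^+ 2 + v ^+ 2 + w ^+ 2.
Proof.
move=> abc mo kE [xa yb za] E K0 [xk yk zk].
pose L := absz (2 * (2 * c * m%:Z))%R.
pose B := absz (2 * c * m%:Z + L.*2%:Z * L.*2%:Z + 4 * L.*2%:Z)%R.
have c0 : 0 < c by case: abc => -[_ _ ->].
have cm0 : 0 < 2 * c * m%:Z by rewrite !mulr_gt0 //; lia.
have L2 : 0 <= L.*2%:Z * L.*2%:Z by rewrite -expr2 sqr_ge0.
have hL : 2 * (2 * c * m%:Z) <= L.*2%:Z by rewrite /L; lia.
have hB : 2 * c * m%:Z + L.*2%:Z * L.*2%:Z + 4 * L.*2%:Z <= B%:Z.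
  by rewrite /B; exact: ler_norm.
have kB : k%:Z <= B%:Z.
  have := ac_cases abc; move: hB kE; rewrite /=.
  by move: (2 * c * _) (L.*2%:Z * _) L2 cm0 hL => p q; lia.
have := kern_count_coef abc mo kE hL hB.
have : kern_count a b B k%:Z != 0.
  rewrite /kern_count -big_filter lt0r_neq0 //.
  rewrite (bigD1_seq (x, y, z)) ?filter_uniq ?box3_uniq //.
    rewrite ltr_pwDl ?lt0r ?K0 ?kern_ge0 // sumr_ge0 // => -[[? ?] ?] _.
    exact: kern_ge0.
  rewrite mem_filter mem_box3 xa yb za E !eqxx /=.
  by rewrite !(le_trans _ kB).
move=> H0 H; move: H0; rewrite H mulf_eq0 negb_or => /andP[_].
move=> /coefM_supp[i [j [-> /coef_theta_supp[u _ ui]]]].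
rewrite expr2 => /coefM_supp[i' [j' [-> /coef_theta_supp[v _ vi] /coef_theta_supp[w _ wi]]]].
by exists u, v, w; rewrite !PoszD ui vi wi addrA.
Qed.

(** Each residue matches one parity class, and [xy + yz + zx = k] has a visible solution there:
    [(1, 0, k)], [(0, 1, k)] or [(1, 1, (k - 1)/2)]. *)
Lemma three_squares (k : nat) : [|| k %% 4 == 1, k %% 4 == 2 | k %% 8 == 3]%N ->
  exists u v w : int, k%:Z = u ^+ 2 + v ^+ 2 + w ^+ 2.
Proof.
move=> hk; have [h|[h|h]] : (k %% 4 = 1 \/ k %% 4 = 2 \/ k %% 8 = 3)%N by lia.
- apply: (@three_squares_class 1 0 1 k (k.+1 %/ 2)%N 1 0 k%:Z).
  + by constructor 2.
  + by lia.
  + by lia.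
  + by split; lia.
  + by ring.
  + by rewrite /kern sgr0 add0r mulf_neq0 // gtr0_sg //; lia.
  by split; lia.
- apply: (@three_squares_class 0 1 1 k (k %/ 2)%N 0 1 k%:Z).
  + by constructor 1.
  + by lia.
  + by lia.
  + by split; lia.
  + by ring.
  + by rewrite /kern sgr0 !add0r !gtr0_sg //; lia.
  by split; lia.
have kE : k = (2 * (k.-1 %/ 2) + 1)%N by lia.
apply: (@three_squares_class 1 1 2 k (k.+1 %/ 4)%N 1 1 (k.-1 %/ 2)%N%:Z).
- by constructor 3.
- by lia.
- by lia.
- by split; lia.
- by lia.
- by rewrite /kern !gtr0_sg //; lia.
by split; lia.
Qed.

(** * Four squares with a prescribed sum *)

Lemma four_squares_sum1 (n : nat) : odd n -> exists x y z w : int,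
  n%:Z = x ^+ 2 + y ^+ 2 + z ^+ 2 + w ^+ 2 /\ x + y + z + w = 1.
Proof.
move=> n_odd; have [|u [v [w E]]] := @three_squares (4 * n - 1)%N; first by lia.
have {}E : 4 * n%:Z - 1 = u ^+ 2 + v ^+ 2 + w ^+ 2 by rewrite -E; lia.
have [u' uE] := odd_evenP u; have [v' vE] := odd_evenP v.
have [w' wE] := odd_evenP w.
(* All three squares are odd, so changing the sign of [u] changes the even number [1 + u + v + w] by
   2 modulo 4. *)
wlog sgn : u u' uE E / ((1 + u + v + w) %% 4)%Z = 0 => [th|].
  have E' : 4 * n%:Z - 1 = (- u) ^+ 2 + v ^+ 2 + w ^+ 2 by rewrite sqrrN.
  have [h|h] : ((1 + u + v + w) %% 4)%Z = 0 \/ ((1 + - u + v + w) %% 4)%Z = 0.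
    by case: uE => uE; case: vE => vE; case: wE => wE;
       move: E; rewrite uE vE wE !expr2; lia.
  - exact: th uE E h.
  - by have [u'' uE'] := odd_evenP (- u); exact: th uE' E' h.
have [x xE] : exists x, 1 + u + v + w = 4 * x.
  by exists ((1 + u + v + w) %/ 4)%Z; lia.
case: uE => uE; case: vE => vE; case: wE => wE;
  try by move: E; rewrite uE vE wE !expr2; lia.
(* These are the numbers [(1 + u + v + w)/4], [(1 + u - v - w)/4], [(1 - u + v - w)/4] and
   [(1 - u - v + w)/4]. *)
exists x, (x - v' - w' - 1), (x - u' - w' - 1), (x - u' - v' - 1).
have xE' : u' = 2 * x - 2 - v' - w' by lia.
by move: E; rewrite uE vE wE xE' !expr2; split; lia.
Qed.

Lemma four_squares_even_sum (n : nat) (h u v w : int) : ~~ odd n ->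
  n%:Z = h ^+ 2 + u ^+ 2 + v ^+ 2 + w ^+ 2 -> exists x y z t : int,
  n%:Z = x ^+ 2 + y ^+ 2 + z ^+ 2 + t ^+ 2 /\ x + y + z + t = 2 * h.
Proof.
move=> n_even E.
have [x xE] : exists x, h + u + v + w = 2 * x.
  exists ((h + u + v + w) %/ 2)%Z.
  have [h' hE] := odd_evenP h; have [u' uE] := odd_evenP u.
  have [v' vE] := odd_evenP v; have [w' wE] := odd_evenP w.
  by case: hE => hE; case: uE => uE; case: vE => vE; case: wE => wE;
     move: E; rewrite hE uE vE wE !expr2; lia.
exists x, (x - v - w), (x - u - w), (x - u - v).
have hE : h = 2 * x - u - v - w by lia.
by move: E; rewrite hE !expr2; split; lia.
Qed.

(** The square [c^2] removes a power of 4 from [n - h^2], so that [three_squares] applies to the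
    cofactor. *)
Lemma four_squares_even_power (m n : nat) (h t : int) (k : nat) (c : int) :
  ~~ odd n -> 2 * h = t ^+ m -> n%:Z = h ^+ 2 + c ^+ 2 * k%:Z ->
  [|| k %% 4 == 1, k %% 4 == 2 | k %% 8 == 3]%N ->
  four_squares_with_sum_power m n.
Proof.
move=> n_even ht nE /three_squares[u [v [w kE]]].
have [|x [y [z [s [E S]]]]] :=
  @four_squares_even_sum n h (c * u) (c * v) (c * w) n_even.
  by rewrite nE kE; ring.
by exists x, y, z, s; split=> //; exists t; rewrite S.
Qed.

Lemma four_squares_scale (m n n' : nat) (r : int) : n'%:Z = (r ^+ m) ^+ 2 * n%:Z ->
  four_squares_with_sum_power m n -> four_squares_with_sum_power m n'.
Proof.
move=> n'E [x [y [z [w [E [t S]]]]]].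
exists (r ^+ m * x), (r ^+ m * y), (r ^+ m * z), (r ^+ m * w); split.
  by rewrite n'E E; ring.
by exists (r * t); rewrite exprMn -S; ring.
Qed.

(** For even [n] the choice is [h = 0] unless this meets the form [4^i (8j + 7)]; then [t = 2], so
    [h = 2] for squares and [h = 4] for cubes. Multiples of [2^(2m)], that is 16 or 64, descend by
    scaling. *)
Lemma four_squares_sum_square_or_cube (m n : nat) : m = 2%N \/ m = 3%N ->
  four_squares_with_sum_power m n.
Proof.
move=> hm; have m0 : (0 < m)%N by case: hm => ->.
have [M] := ubnP n; elim: M n => // M IH n nM.
have [n_odd|n_even] := boolP (odd n).
  have [x [y [z [w [E S]]]]] := four_squares_sum1 n_odd.
  by exists x, y, z, w; split=> //; exists 1; rewrite expr1n.
have t0 : 2 * 0 = 0 ^+ m :> int by rewrite expr0n; case: (m) m0.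
have [n2|n4] : (n %% 4 = 2 \/ n %% 4 = 0)%N by lia.
  by apply: (four_squares_even_power (k := n) (c := 1) n_even t0); lia.
pose k := (n %/ 4)%N.
have [kC|[k7|k4]] : [|| k %% 4 == 1, k %% 4 == 2 | k %% 8 == 3]%N \/
    (k %% 8 = 7 \/ k %% 4 = 0)%N by lia.
- by apply: (four_squares_even_power (c := 2) n_even t0 _ kC); lia.
(* Here [k] is 7 modulo 8, so [k - 1] is 6 and [k - 4] is 3 modulo 8; both are admissible. *)
- case: hm => ->.
    by apply: (@four_squares_even_power 2 n 2 2 (k - 1) 2 n_even); lia.
  by apply: (@four_squares_even_power 3 n 4 2 (k - 4) 2 n_even); lia.
pose j := (k %/ 4)%N.
have nj : n = (16 * j)%N by lia.
have [n0|n0] := posnP n.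
  exists 0, 0, 0, 0; rewrite n0; split; first by rewrite expr0n.
  by exists 0; rewrite -t0 mulr0.
case: hm => mE; rewrite mE in IH *.
  by apply: (@four_squares_scale 2 j n 2); [lia | apply: IH; lia].
have [jC|[j7|j4]] : [|| j %% 4 == 1, j %% 4 == 2 | j %% 8 == 3]%N \/
    (j %% 8 = 7 \/ j %% 4 = 0)%N by lia.
- by apply: (@four_squares_even_power 3 n 0 0 j 4 n_even) => //; lia.
- by apply: (@four_squares_even_power 3 n 4 2 (j - 1) 4 n_even); lia.
by apply: (@four_squares_scale 3 (j %/ 4) n 2); [lia | apply: IH; lia].
Qed.

(** * The obstruction to exponents above three *)

Lemma sum3_squares_4 (u v w k : int) : u ^+ 2 + v ^+ 2 + w ^+ 2 = 4 * k ->
  exists u' v' w' : int, u' ^+ 2 + v' ^+ 2 + w' ^+ 2 = k.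
Proof.
move=> E; have [u' uE] := odd_evenP u; have [v' vE] := odd_evenP v.
have [w' wE] := odd_evenP w; exists u', v', w'.
by case: uE => uE; case: vE => vE; case: wE => wE;
   move: E; rewrite uE vE wE !expr2; lia.
Qed.

Lemma sqr_mod8 (u : int) :
  [\/ (u ^+ 2 %% 8)%Z = 0, (u ^+ 2 %% 8)%Z = 1 | (u ^+ 2 %% 8)%Z = 4].
Proof.
have [u' uE] := odd_evenP u; have [v vE] := odd_evenP u'; rewrite expr2.
by case: uE => ->; case: vE => ->;
   [constructor 1 | constructor 3 | constructor 2 | constructor 2]; lia.
Qed.

Lemma sum3_squares_mod8 (u v w : int) : ((u ^+ 2 + v ^+ 2 + w ^+ 2) %% 8)%Z != 7.
Proof.
by case: (sqr_mod8 u) => hu; case: (sqr_mod8 v) => hv; case: (sqr_mod8 w) => hw; lia.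
Qed.

(** The sum of the four numbers has the parity of [n], so [t] is even and for [m >= 4] the sum is
    [16q]. Then [4n - (16q)^2] is a sum of three squares equal to 16 times a number that is 7 modulo
    8. *)
Lemma sum_power_le3 (m n : nat) : n = 28 %[mod 32] ->
  four_squares_with_sum_power m n -> (m <= 3)%N.
Proof.
move=> nE [x [y [z [w [E [t S]]]]]]; rewrite leqNgt; apply/negP => m3.
have [q qE] : exists q, x + y + z + w = 16 * q.
  have [t' [tE|tE]] := odd_evenP t.
    exists (t' ^+ 4 * t ^+ (m - 4)); rewrite S -{1}(subnKC m3) exprD {1}tE; ring.
  have : ((x + y + z + w) %% 2)%Z = 1.
    rewrite S; elim: (m) => [|i IHi]; first by rewrite expr0.
    have [r [rE|rE]] := odd_evenP (t ^+ i); first by lia.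
    by rewrite exprS rE tE; lia.
  have [x' xE] := odd_evenP x; have [y' yE] := odd_evenP y.
  have [z' zE] := odd_evenP z; have [w' wE] := odd_evenP w.
  by case: xE => xE; case: yE => yE; case: zE => zE; case: wE => wE;
     move: E; rewrite xE yE zE wE !expr2; lia.
have [l lE] : exists l, n%:Z = 28 + 32 * l by exists (n%:Z %/ 32)%Z; lia.
(* The squares of these three numbers and of [x + y + z + w] add up to [4n]. *)
have [] := @sum3_squares_4 (x + y - z - w) (x - y + z - w) (x - y - z + w)
  (4 * (7 + 8 * l - 16 * q ^+ 2)).
  have xq : x = 16 * q - y - z - w by lia.
  by move: E; rewrite lE xq !expr2; lia.
move=> u [v [r /sum3_squares_4[u' [v' [r' H]]]]].
have := sum3_squares_mod8 u' v' r'; rewrite H.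
by move: (q ^+ 2) => p; clear; lia.
Qed.

Close Scope ring_scope.

Theorem theorem1p3 :
  (forall m : nat, m = 2 \/ m = 3 ->
     forall n : nat, four_squares_with_sum_power m n) /\
  (forall m n : nat, 0 < m -> 0 < n -> n = 28 %[mod 32] ->
     four_squares_with_sum_power m n -> m <= 3).
Proof.
split=> [m hm n | m n _ _]; first exact: four_squares_sum_square_or_cube.
exact: sum_power_le3.
Qed.
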